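(* Let $k\ge 2$ be a constant. There is a constant $\ell$ (one may take $\ell=k$) such that every deterministic $\mathsf{Online}$-$\mathsf{LOCAL}$ algorithm that properly colors every $n$-node connected graph in $\mathcal{L}_{k,\ell}$ using colors from $\{1,\dots,k+1\}$ has locality $\Omega(\log n)$.
   Context: A graph is $k$-partite if it admits a proper coloring with $k$ colors. For a graph $G=(V,E)$, $U\subseteq V$ and an integer $T\ge 0$, $\mathcal{B}(U,T)$ denotes the set of nodes at distance at most $T$ from some node of $U$, and $G[U]$ denotes the induced subgraph. Locally inferable unique colorings: let $G$ be a $k$-partite graph and $\ell\ge0$ an integer. For a connected subgraph $G'=(V',E')$ of $G$, let $\mathcal{C}^*(G',\ell)$ be the set of all proper $k$-colorings (colors $\{1,\dots,k\}$) of $G[\mathcal{B}(V',\ell)]$, and $\mathcal{C}(G',\ell)$ the set of restrictions to $V'$ of colorings in $\mathcal{C}^*(G',\ell)$. Two $k$-colorings $c,c'$ are identical up to a permutation if $c'=\phi\circ c$ for some permutation $\phi$ of $\{1,\dots,k\}$. $\mathcal{L}_{k,\ell}$ is the class of $k$-partite graphs $G$ such that for every connected subgraph $G'$ of $G$, all colorings in $\mathcal{C}(G',\ell)$ are identical up to a permutation. The $\mathsf{Online}$-$\mathsf{LOCAL}$ model: an algorithm with locality $T=T(n)$ is deterministic and knows $n$. The adversary chooses an $n$-node input graph $G=(V,E)$ from the input family, assigns distinct identifiers from $\{1,\dots,\mathrm{poly}(n)\}$ to its nodes, and chooses an ordering $\sigma=(v_1,\dots,v_n)$ of $V$. For $i=1,\dots,n$,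 when $v_i$ is presented, the algorithm must irrevocably assign an output (here a color) to $v_i$ as a function of the sequence $(v_1,\dots,v_i)$ and the induced subgraph $G_i=G\big[\bigcup_{j\le i}\mathcal{B}(v_j,T)\big]$ (with identifiers); thus the algorithm has global memory of everything seen so far. The algorithm solves a coloring problem on an input family if for every choice of the adversary the final coloring is proper and uses only the allowed colors. The locality of a problem is the minimum locality of an algorithm solving it. *)

(* Defs.v *)
From mathcomp Require Import all_boot all_order all_fingroup.
Set Implicit Arguments. Unset Strict Implicit. Unset Printing Implicit Defensive.

Definition simple_graph (n : nat) (e : rel 'I_n) : Prop :=
  symmetric e /\ irreflexive e.

Definition connected_graph (n : nat) (e : rel 'I_n) : Prop :=
  forall x y : 'I_n, connect e x y.

Definition nbhd (n : nat) (e : rel 'I_n) (A : {set 'I_n}) : {set 'I_n} :=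
  A :|: [set y | [exists x in A, e x y]].
Definition ball (n : nat) (e : rel 'I_n) (A : {set 'I_n}) (T : nat) : {set 'I_n} :=
  iter T (nbhd e) A.

Definition proper_on (n : nat) (e : rel 'I_n) (S : {set 'I_n}) (C : eqType)
    (c : 'I_n -> C) : Prop :=
  forall x y, x \in S -> y \in S -> e x y -> c x != c y.

Definition k_partite (n k : nat) (e : rel 'I_n) : Prop :=
  exists c : 'I_n -> 'I_k, proper_on e setT c.

(* The class L_{k,l}. A connected subgraph G'=(V',E') of G is given by a
   vertex set V' and a symmetric edge relation E' contained in G[V']. *)
Definition in_L (n k l : nat) (e : rel 'I_n) : Prop :=
  k_partite k e /\
  forall (V' : {set 'I_n}) (E' : rel 'I_n),
    (forall x y, E' x y -> [&& x \in V', y \in V' & e x y]) ->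
    symmetric E' ->
    (forall x y, x \in V' -> y \in V' -> connect E' x y) ->
    forall c1 c2 : 'I_n -> 'I_k,
      proper_on e (ball e V' l) c1 -> proper_on e (ball e V' l) c2 ->
      exists phi : {perm 'I_k}, forall v, v \in V' -> c2 v = phi (c1 v).

(* What the algorithm sees at step i, with identifiers in 'I_M
   (identifier j : 'I_M stands for j+1 in {1..M}):
   the identifiers of v_1..v_i in order, and the induced subgraph
   G_i = G[ B({v_1..v_i}, T) ] labeled by identifiers. *)
Definition view (M : nat) : Type :=
  (seq 'I_M * {set 'I_M} * {set 'I_M * 'I_M})%type.

(* 0-based step i: presented prefix is take i.+1 s. *)
Definition online_view (n M : nat) (e : rel 'I_n) (id : 'I_n -> 'I_M)
    (s : seq 'I_n) (T i : nat) : view M :=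
  let P := take i.+1 s in
  let U := ball e [set x in P] T in
  (map id P, id @: U, [set (id x, id y) | x in U, y in U & e x y]).

(* Deterministic Online-LOCAL algorithm (for a fixed, known n): a function
   of the view. The color of v is the output at the step where v is presented. *)
Definition online_coloring (n M : nat) (e : rel 'I_n) (id : 'I_n -> 'I_M)
    (s : seq 'I_n) (T : nat) (A : view M -> nat) (v : 'I_n) : nat :=
  A (online_view e id s T (index v s)).

Definition solves (n M k l T : nat) (A : view M -> nat) : Prop :=
  forall e : rel 'I_n, simple_graph e -> connected_graph e -> in_L k l e ->
  forall id : 'I_n -> 'I_M, injective id ->
  forall s : seq 'I_n, uniq s -> size s = n ->
    (forall x y, e x y -> online_coloring e id s T A x <> online_coloring e id s T A y) /\
    (forall v, 1 <= online_coloring e id s T A v <= k.+1).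
Arguments solves : clear implicits.

(* Main.v *)
Require Import Defs.
From mathcomp Require Import all_boot all_order all_fingroup.
From mathcomp Require Import zify.
Set Implicit Arguments. Unset Strict Implicit. Unset Printing Implicit Defensive.

(** The graph is a strip: positions [p < W], heights [h < T + 2], and [(p, h)]
    adjacent to [(q, h')] when [0 < |p - q| < k] and [|h - h'| <= 1]; its color
    classes are the residues of [p] mod [k]. Above the top row sit hubs, one of
    each residue (spare vertices are copies of hub [0]), adjacent to all
    top row vertices and hubs of other residues. The algorithm is only shown row [0] until it
    has lost, so that it never sees a hub.

    In a coloring with [k + 1] colors, sliding a window of [k] consecutive
    positions by one step either keeps the color of one residue or replaces it
    by the unique color missing in the window. Undoing a replacement is
    replacing the color of the same residue again, so windows walk in the
    [k]-regular tree of reduced words over the residues. Moving the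
    walk up by one row changes the distance between its ends by at most [4k],
    and on the periodic row of hubs nothing moves: on row [0], two windows are
    never further apart than [4k(T + 2)].

    The adversary defeats this bound. Given two separate fragments of row [0]
    whose walks have diameter [L], it may join them directly or with a spare
    column in between. If the joint walk still has diameter [L], then the two
    diameters share their midpoint, so both fragments show there the same color
    on each residue; this fails for one of the two joints, as they shift the
    residues by one. So each doubling of the width increases the diameter, and
    a width of [2^O(kT)] is enough. *)

(** * The tree of reduced words *)

Fixpoint lcp (s t : seq nat) : nat :=
  match s, t with
  | x :: s', y :: t' => if x == y then (lcp s' t').+1 else 0
  | _, _ => 0
  end.

Lemma lcpC s t : lcp s t = lcp t s.
Proof. by elim: s t => [|x s IH] [|y t] //=; rewrite eq_sym IH. Qed.

Lemma lcp_size s t : lcp s t <= size s.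
Proof. by elim: s t => [|x s IH] [|y t] //=; case: eqP => // _; apply: IH. Qed.

Lemma lcp_ultra s t u : minn (lcp s t) (lcp t u) <= lcp s u.
Proof.
elim: s t u => [|x s IH] [|y t] [|z u] //=; rewrite ?minn0 ?min0n //.
have := IH t u; case: (x =P y); case: (y =P z); case: (x =P z); try congruence; lia.
Qed.

Lemma lcp_full s t : lcp s t = size s -> lcp s t = size t -> s = t.
Proof.
elim: s t => [|x s IH] [|y t] //=; case: eqP => // -> [e1] [e2]; congr (_ :: _).
exact: IH.
Qed.

Lemma lcp_cat z s t : lcp (z ++ s) (z ++ t) = size z + lcp s t.
Proof. by elim: z => //= x z ->; rewrite eqxx. Qed.

(* Vertices of the tree are reduced words, stored with the last letter first. *)
Definition push (j : nat) (s : seq nat) : seq nat :=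
  if s is x :: s' then if x == j then s' else j :: s else [:: j].

Definition reduced (s : seq nat) := sorted (fun x y => x != y) s.

Lemma reduced_push j s : reduced s -> reduced (push j s).
Proof.
case: s => // x s /=; case: eqP => [_|/eqP]; first exact: path_sorted.
by rewrite /reduced /= eq_sym => -> ->.
Qed.

Lemma pushK j s : reduced s -> push j (push j s) = s.
Proof.
case: s => [|x s] /=; first by rewrite eqxx.
rewrite /reduced /=; case: eqP => [<-|_] /=; last by rewrite eqxx.
by case: s => //= y s; rewrite eq_sym; case: eqP.
Qed.

Lemma size_push j s : size (push j s) <= (size s).+1 <= (size (push j s)).+2.
Proof. by case: s => //= x s; case: eqP => _ /=; lia. Qed.

(** Words carry their last letter first, so a common ancestor is a common suffix; [lca] is the depth
    of the deepest one. *)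
Definition lca (p q : seq nat) := lcp (rev p) (rev q).
Definition tdist (p q : seq nat) := size p + size q - (lca p q).*2.

Lemma lcaC p q : lca p q = lca q p.
Proof. exact: lcpC. Qed.

Lemma lca_size p q : lca p q <= size p.
Proof. by rewrite -(size_rev p) lcp_size. Qed.

Lemma lca_ultra p q r : minn (lca p q) (lca q r) <= lca p r.
Proof. exact: lcp_ultra. Qed.

Lemma lca_full p q : lca p q = size p -> lca p q = size q -> p = q.
Proof.
rewrite -(size_rev p) -(size_rev q) => h1 h2.
by apply: (can_inj revK); apply: lcp_full.
Qed.

Lemma lca_suffix x z : lca z (x ++ z) = size z.
Proof. by rewrite /lca rev_cat -[rev z in X in lcp X _]cats0 lcp_cat /= size_rev addn0. Qed.

(* [g] is the word read along the geodesic from [p] to [q]. *)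
Definition geodesic (p q g : seq nat) :=
  exists x y z, [/\ q = x ++ z, p = y ++ z, g = x ++ rev y
    & lcp (rev x) (rev y) = 0].

Lemma geodesic_size p q g : geodesic p q g -> tdist p q = size g.
Proof.
move=> [x [y [z [-> -> -> h]]]].
rewrite /tdist /lca !rev_cat lcp_cat lcpC h !size_cat !size_rev; lia.
Qed.

Lemma geodesic_refl p : geodesic p p [::].
Proof. by exists [::], [::], p. Qed.

(** The tree is the Cayley graph of a free product of groups of order 2. There [push j] is left
    multiplication by [j], and [g] is [q] times the inverse of [p], so both gain the same left
    factor. The cases follow where the letter cancels. *)
Lemma geodesic_push j p q g :
  reduced p -> geodesic p q g -> geodesic p (push j q) (push j g).
Proof.
move=> rp [x [y [z [-> ep -> h]]]].
case: x h => [|a x] h /=; last first.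
  case: eqP => [ea|nea].
    exists x, y, z; split=> //.
    by move: h; rewrite rev_cons; case: (rev x) => [|b s]; case: (rev y) => [|c t] //=; case: ifP.
  exists [:: j, a & x], y, z; split=> //.
  by move: h; rewrite !rev_cons; case: (rev x) => [|b s]; case: (rev y) => [|c t] //=; case: ifP.
case/lastP: y ep h => [|y b] ep h.
  case: z ep => [|c z] ep /=; first by exists [:: j], [::], [::].
  case: eqP => [ec|nec].
    by exists [::], [:: c], z; rewrite ep ec.
  by exists [:: j], [::], (c :: z).
rewrite rev_rcons /=.
case: z ep => [|c z] ep /=.
  case: eqP => [eb|neb].
    by exists [::], y, [:: b]; rewrite ep cats0 -cats1 eb.
  exists [:: j], (rcons y b), [::]; split; rewrite ?rev_rcons //=.
  by case: eqP neb => // ->.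
(* If [b] and [c] were both [j], pushing [j] would shorten [g] while the path from [p] gets longer;
   reducedness of [p] excludes this. *)
have nbc : b != c.
  move: rp; rewrite ep cat_rcons /reduced => /cat_sorted2[_ /=].
  by case/andP.
case: (eqVneq c j) => [ec|nec].
  have -> : (b == j) = false by rewrite -ec; apply/negbTE.
  exists [::], (rcons (rcons y b) c), z; split=> //.
  - by rewrite ep -[rcons (rcons _ _) _]cats1 -catA.
  - by rewrite !rev_rcons ec.
case: (eqVneq b j) => [eb|neb].
  by exists [::], y, (b :: c :: z); rewrite ep cat_rcons eb.
exists [:: j], (rcons y b), (c :: z); split; rewrite ?rev_rcons //=.
by rewrite eq_sym (negbTE neb).
Qed.

(** * Walks of windows in a row *)

Section Walk.
Variable k : nat.
Implicit Types f F : nat -> nat.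

(* When the window moves on from position [x], it loses [x] and gains [x + k],
   of the same residue. *)
Fixpoint walk f (a : nat) p (n : nat) : seq nat :=
  if n is n'.+1 then
    let q := walk f a p n' in
    if f (a + n') == f (a + n' + k) then q else push ((a + n') %% k) q
  else p.

(** By [tdist_walk], this is the distance in the tree between the first and the last window. *)
Definition drift f a n := size (walk f a [::] n).

Lemma reduced_walk f a p n : reduced p -> reduced (walk f a p n).
Proof. by move=> rp; elim: n => //= n IH; case: ifP => // _; apply: reduced_push. Qed.

Lemma walk_add f a p m n : walk f a p (m + n) = walk f (a + m) (walk f a p m) n.
Proof. by elim: n => [|n IH]; rewrite ?addn0 // addnS /= IH addnA. Qed.

Lemma eq_walk f F a p n : (forall x, a <= x < a + n + k -> f x = F x) ->
  walk f a p n = walk F a p n.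
Proof.
elim: n => //= n IH h; rewrite IH; last by move=> x hx; apply: h; lia.
by rewrite !h //; lia.
Qed.

Lemma geodesic_walk f a p n :
  reduced p -> geodesic p (walk f a p n) (walk f a [::] n).
Proof.
move=> rp; elim: n => [|n IH] /=; first exact: geodesic_refl.
by case: ifP => // _; apply: geodesic_push.
Qed.

Lemma tdist_walk f a p n :
  reduced p -> tdist p (walk f a p n) = drift f a n.
Proof. by move=> rp; apply: geodesic_size; apply: geodesic_walk. Qed.

Lemma drift_between f a m n : m <= n ->
  tdist (walk f a [::] m) (walk f a [::] n) = drift f (a + m) (n - m).
Proof.
move=> mn; have := walk_add f a [::] m (n - m); rewrite subnKC // => ->.
by rewrite tdist_walk //; apply: reduced_walk.
Qed.

Lemma modn_near a b : a < b < a + k -> a %% k != b %% k.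
Proof.
move=> ab; rewrite eq_sym eqn_mod_dvd; last by lia.
apply/negP => /dvdn_leq; lia.
Qed.

Lemma modn_neq p q : p != q -> p < q + k -> q < p + k -> p %% k != q %% k.
Proof.
move=> pq qp pk; case: (ltngtP p q) pq => // pq _; first by apply: modn_near; lia.
by rewrite eq_sym; apply: modn_near; lia.
Qed.

Lemma window_inj p q w : w <= p < w + k -> w <= q < w + k -> p %% k = q %% k -> p = q.
Proof.
move=> hp hq e; apply/eqP; apply: contraT => ne; have := modn_neq ne.
by rewrite e eqxx /= => h; apply: h; move: hp hq; clear; lia.
Qed.

(** Boolean, since [drift_merge] splits on whether a piece is already badly colored. *)
Definition valid f (lo hi : nat) : bool :=
  [forall p : 'I_hi, (lo <= p) ==> (0 < f p <= k.+1) &&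
    [forall q : 'I_hi, (p < q < p + k) ==> (f p != f q)]].

Lemma validP f lo hi : reflect
  ((forall p, lo <= p < hi -> 0 < f p <= k.+1) /\
   (forall p q, lo <= p -> p < q < p + k -> q < hi -> f p != f q))
  (valid f lo hi).
Proof.
apply: (iffP forallP) => [h|[h1 h2] p].
  split=> [p /andP[lp ph]|p q lp pq qh].
    by have /implyP/(_ lp)/andP[] := h (Ordinal ph).
  have ph : p < hi by lia.
  have /implyP/(_ lp)/andP[_ /forallP/(_ (Ordinal qh))/implyP] := h (Ordinal ph).
  exact.
apply/implyP => lp; rewrite h1 ?lp //=.
by apply/forallP => q; apply/implyP => pq; apply: h2.
Qed.

Lemma valid_sub f lo hi lo' hi' :
  valid f lo hi -> lo <= lo' -> hi' <= hi -> valid f lo' hi'.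
Proof.
move=> /validP[h1 h2] l h; apply/validP; split=> [p hp|p q lp pq qh].
  by apply: h1; lia.
by apply: h2 => //; lia.
Qed.

Lemma eq_valid f F lo hi : (forall x, lo <= x < hi -> f x = F x) ->
  valid f lo hi -> valid F lo hi.
Proof.
move=> e /validP[h1 h2]; apply/validP; split=> [p hp|p q lp pq qh].
  by rewrite -e // h1.
by rewrite -!e ?h2 //; lia.
Qed.

Lemma valid_shift f c lo hi :
  valid f (c + lo) (c + hi) -> valid (fun x => f (c + x)) lo hi.
Proof.
move=> /validP[h1 h2]; apply/validP; split=> [p hp|p q lp pq qh].
  by apply: h1; lia.
by apply: h2 => //; lia.
Qed.

Lemma color_uniq_size (s : seq nat) :
  uniq s -> {in s, forall c, 0 < c <= k.+1} -> size s <= k.+1.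
Proof.
move=> us hs; rewrite -(size_iota 1 k.+1); apply: uniq_leq_size => // c cs.
by rewrite mem_iota; have := hs c cs; lia.
Qed.

(* Otherwise [c] and the positions [w, ..., w + k] carry [k + 2] colors. *)
Lemma no_extra_color f lo hi w c : valid f lo hi -> lo <= w -> w + k < hi ->
  f w != f (w + k) -> 0 < c <= k.+1 ->
  exists2 x, w <= x <= w + k & c = f x.
Proof.
move=> vf lw wh nf hc.
have [h1 h2] := validP _ _ _ vf.
case: (boolP (c \in map f (iota w k.+1))) => [/mapP[x]|nc].
  by rewrite mem_iota => hx ->; exists x => //; lia.
have ir : {in iota w k.+1 &, injective f}.
  move=> x y; rewrite !mem_iota.
  wlog xy : x y / x <= y => [th hx hy e|hx hy e].
    by case: (leqP x y) => xy; [|symmetry]; apply: th => //; lia.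
  case: (ltngtP x y) xy => // xy _.
  case: (ltnP y (x + k)) => xyk.
    by have := h2 x y; rewrite e eqxx => /(_ ltac:(lia) ltac:(lia) ltac:(lia)).
  have ex : x = w by lia.
  have ey : y = w + k by lia.
  by move: nf; rewrite -ex ex -ey -ex e eqxx.
suff : size (c :: map f (iota w k.+1)) <= k.+1.
  by rewrite /= size_map size_iota ltnn.
apply: color_uniq_size; first by rewrite cons_uniq nc (map_inj_in_uniq ir) iota_uniq.
move=> d; rewrite in_cons => /orP[/eqP->//|/mapP[x]].
by rewrite mem_iota => hx ->; apply: h1; lia.
Qed.


Hypothesis hk : 2 <= k.

Lemma ltn_modk a : a %% k < k.
Proof. by rewrite ltn_mod; lia. Qed.

(* The position of the window [w, ..., w + k - 1] congruent to [r]. *)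
Definition in_window w r := w + (r + w * k.-1) %% k.

Lemma in_windowP w r : w <= in_window w r < w + k /\ in_window w r %% k = r %% k.
Proof.
rewrite leq_addr ltn_add2l ltn_modk //; split=> //.
rewrite /in_window modnDmr addnCA -mulnS prednK; last by apply: ltnW.
by rewrite addnC modnMDl.
Qed.

Lemma map_push (r : nat -> nat) j p : j < k -> all (ltn^~ k) p ->
  {in [pred x | x < k] &, injective r} ->
  map r (push j p) = push (r j) (map r p).
Proof.
move=> jk; case: p => //= x p /andP[xk _] ir.
by rewrite (inj_in_eq ir) //; case: ifP.
Qed.

Lemma walk_letters f a p n : all (ltn^~ k) p -> all (ltn^~ k) (walk f a p n).
Proof.
move=> hp; elim: n => //= n; case: ifP => // _.
have := ltn_modk (a + n); case: (walk _ _ _ _) => [|x s] /= hx; first by rewrite hx.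
by move=> /andP[h1 h2]; case: ifP => _ //=; rewrite hx h1.
Qed.

(** Shifting positions rotates the letters, an injective relabelling that commutes with [push] and
    preserves lengths. *)
Lemma drift_shift f c a n : drift (fun x => f (c + x)) a n = drift f (c + a) n.
Proof.
pose r x := (c + x) %% k.
suff h : map r (walk (fun x => f (c + x)) a [::] n) = walk f (c + a) [::] n.
  by rewrite /drift -h size_map.
have ir : {in [pred x | x < k] &, injective r}.
  move=> x y xk yk /eqP; rewrite eqn_modDl => /eqP.
  by rewrite !modn_small.
elim: n => //= n IH; rewrite !addnA.
case: ifP => // _; rewrite (map_push _ _ ir) ?ltn_modk ?walk_letters // IH.
by rewrite /r modnDmr addnA.
Qed.

(** In a window, the other [k - 1] positions leave two colors for [s], so recoloring [s] swaps its
    color with the missing one: a single step of the tree. The walks thus differ by the letter of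
    [s] while the window contains [s], and agree otherwise. *)
Lemma walk_recolor f F lo hi (s : nat) a p n :
  valid f lo hi -> valid F lo hi -> (forall x : nat, x != s -> f x = F x) ->
  lo <= a -> a + n + k <= hi -> reduced p ->
  let toggle i q := if (i <= s < i + k) && (f s != F s) then push (s %% k) q else q in
  walk F a (toggle a p) n = toggle (a + n) (walk f a p n).
Proof.
move=> vf vF e la nh rp toggle; elim: n nh => [|n IH] nh; first by rewrite addn0.
rewrite /= IH; last by lia.
have rw : reduced (walk f a p n) by apply: reduced_walk.
have [f1 f2] := validP _ _ _ vf; have [F1 F2] := validP _ _ _ vF.
set w := a + n in nh *; set q := walk f a p n in rw *.
have -> : a + n.+1 = w.+1 by rewrite /w; lia.
rewrite /toggle; case: (eqVneq (f s) (F s)) => [es|ns].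
  have ef x : f x = F x by case: (eqVneq x s) => [->|/e].
  by rewrite !andbF !ef.
rewrite !andbT.
(* A replacement at [w] means that the positions from [w] to [w + k] show all [k + 1] colors; the
   new color of [s] is among them, and properness of [F] leaves only the two ends. *)
have key : w <= s <= w + k -> f w != f (w + k) -> F s = f w \/ F s = f (w + k).
  move=> hs nf.
  have [|||x hx ex] := no_extra_color vf _ _ nf (F1 s _); [lia..|].
  case: (eqVneq x s) ex => [->|xs] ex; first by rewrite ex eqxx in ns.
  case: (eqVneq x w) ex => [->|xw] ex; first by left.
  case: (eqVneq x (w + k)) ex => [->|xk] ex; first by right.
  have := ex; rewrite (e _ xs) => {}ex.
  case: (ltngtP x s) xs => // xs _; [have := F2 x s | have := F2 s x];
    rewrite ex eqxx => /(_ ltac:(lia) ltac:(lia) ltac:(lia)) //.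
have nsym : F s != f s by rewrite eq_sym.
(* Here [s] leaves the window; in the next case it enters. *)
case: (eqVneq s w) => [sw|sw].
  have swk : w + k != s by lia.
  rewrite -sw in key swk *.
  have -> : s <= s < s + k by lia.
  have -> : (s < s < s.+1 + k) = false by lia.
  rewrite -(e _ swk); case: (eqVneq (f s) (f (s + k))) => [fe|fe].
    by rewrite -fe (negbTE nsym) pushK.
  have [|//|h|h] := key; first by lia.
    by rewrite h eqxx in nsym.
  by rewrite h eqxx.
case: (eqVneq s (w + k)) => [sk|sk].
  have sw' : w != s by rewrite eq_sym.
  have e1 : (w + k) %% k = w %% k by rewrite modnDr.
  rewrite -sk in key e1 *.
  have -> : (w <= s < s) = false by lia.
  have -> : w < s < w.+1 + k by lia.
  rewrite -(e _ sw') e1; case: (eqVneq (f w) (f s)) => [fe|fe].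
    by rewrite fe (negbTE ns).
  have [|//|h|h] := key; first by lia.
    by rewrite h eqxx pushK.
  by rewrite h eqxx in nsym.
(* If [s] is strictly inside, a replacement would give it the color of a neighbor, so neither walk
   moves. *)
have ew : f w = F w by apply: e; rewrite eq_sym.
have ewk : f (w + k) = F (w + k) by apply: e; rewrite eq_sym.
rewrite -ew -ewk.
have -> : (w < s < w.+1 + k) = (w <= s < w + k) by lia.
case: (boolP (w <= s < w + k)) => hs //.
case: (eqVneq (f w) (f (w + k))) => [//|nf].
have [|//|h|h] := key; first by lia.
  have := F2 w s; rewrite h -ew eqxx => /(_ ltac:(lia) ltac:(lia) ltac:(lia)) //.
have := F2 s (w + k); rewrite h -ewk eqxx => /(_ ltac:(lia) ltac:(lia) ltac:(lia)) //.
Qed.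

Lemma size_walk f a p n : reduced p -> size (walk f a p n) <= size p + drift f a n.
Proof.
move=> rp; rewrite -(tdist_walk f a n rp) /tdist.
by have := lca_size p (walk f a p n); lia.
Qed.

(** A toggle at either end of the walk changes the length by at most 1, and needs [s] in the first
    or the last window. *)
Lemma drift_recolor f F lo hi (s : nat) a n :
  valid f lo hi -> valid F lo hi -> (forall x : nat, x != s -> f x = F x) ->
  lo <= a -> a + n + k <= hi ->
  drift f a n <= drift F a n + (((s < a + k) || (a + n <= s)) : nat).*2.
Proof.
move=> vf vF e la nh; have := walk_recolor vf vF e la nh (isT : reduced [::]).
move=> /=.
set b1 := (a <= s < a + k) && _; set b2 := (a + n <= s < a + n + k) && _ => h.
have rp : reduced (if b1 then push (s %% k) [::] else [::]) by case: ifP.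
have := size_walk F a n rp; rewrite h {h rp}.
have := size_push (s %% k) (walk f a [::] n).
rewrite /drift {}/b1 {}/b2; case: (f s == F s); rewrite ?andbF ?andbT /=; first by lia.
by case: (boolP (a <= s < _)) => q1; case: (boolP (a + n <= s < _)) => q2 /=; lia.
Qed.

(** The row is recolored from left to right, one position at a time; at most [minn m k + (m - n)]
    positions lie in the first or the last window and cost 2 each. *)
Lemma drift_interpolate f F a m n :
  (forall s, a <= s <= a + m ->
     valid (fun x => if x < s then F x else f x) a (a + n + k)) ->
  m <= n + k ->
  drift f a n <= drift (fun x => if x < a + m then F x else f x) a n
                 + (minn m k + (m - n)).*2.
Proof.
elim: m => [|m IH] v mn.
  rewrite /drift (@eq_walk f (fun x => if x < a + 0 then F x else f x)) => [|x hx]; first by lia.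
  by have -> : x < a + 0 = false by lia.
apply: leq_trans (IH _ _) _; [by move=> s hs; apply: v; lia | by lia |].
have := drift_recolor (v (a + m) _) (v (a + m.+1) _) _ (leqnn a) (leqnn _).
move/(_ (a + m)) => h.
apply: leq_trans (leq_add (h _ _ _) (leqnn _)) _; [by lia | by lia | | by lia].
by move=> x hx; congr (if _ then _ else _); lia.
Qed.


Lemma drift_row f F a n :
  (forall s, a <= s <= a + (n + k) ->
     valid (fun x => if x < s then F x else f x) a (a + n + k)) ->
  drift f a n <= drift F a n + 4 * k.
Proof.
move=> v; have := drift_interpolate v (leqnn _).
rewrite (_ : drift (fun x => if x < a + (n + k) then F x else f x) a n = drift F a n); last first.
  by rewrite /drift (@eq_walk _ F) // => x hx; have -> : x < a + (n + k) by lia.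
lia.
Qed.

Lemma drift_periodic f a n : (forall x, f (x + k) = f x) -> drift f a n = 0.
Proof.
move=> h; rewrite /drift; have -> // : walk f a [::] n = [::].
by elim: n => //= n ->; rewrite h eqxx.
Qed.

(* [tau] colors the residues mod [k]; [tau k] is the color missing in the window. *)
Definition exchange (j : nat) (tau : nat -> nat) (r : nat) : nat :=
  if r == j then tau k else if r == k then tau j else tau r.

Definition replay (tau : nat -> nat) (p : seq nat) := foldr exchange tau p.

Lemma exchangeK j tau r : j < k -> exchange j (exchange j tau) r = tau r.
Proof.
move=> jk; have kj : (k == j) = false by rewrite eq_sym ltn_eqF.
rewrite /exchange !eqxx kj.
by case: eqP => [->//|_]; case: eqP => [->|].
Qed.

Lemma replay_push tau j p r :
  j < k -> replay tau (push j p) r = exchange j (replay tau p) r.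
Proof.
move=> jk; case: p => //= x p; case: (eqVneq x j) => [->|//].
by rewrite exchangeK.
Qed.

(** A replacement swaps the color of one residue with the missing color, so the initial window and
    the tree vertex determine the colors of the current window. *)
Lemma replay_walk f lo hi a n : valid f lo hi -> lo <= a -> a + n + k <= hi ->
  exists tau, forall m, m <= n ->
    let sigma := replay tau (walk f a [::] m) in
    [/\ forall p, a + m <= p < a + m + k -> f p = sigma (p %% k),
        0 < sigma k <= k.+1 &
        forall p, a + m <= p < a + m + k -> f p != sigma k].
Proof.
move=> vf la nh; have [f1 f2] := validP _ _ _ vf.
have [c hc nc] : exists2 c, 0 < c <= k.+1 & c \notin map f (iota a k).
  case: (boolP (all (fun c => c \in map f (iota a k)) (iota 1 k.+1))) => [/allP h|].
    have := uniq_leq_size (iota_uniq 1 k.+1) h.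
    by rewrite size_map !size_iota ltnn.
  by case/allPn => c; rewrite mem_iota => hc nc; exists c => //; lia.
pose tau r := if r == k then c else f (in_window a r).
have tauk : tau k = c by rewrite /tau eqxx.
exists tau => m; elim: m => [|m IH] mn /=.
  rewrite addn0; split=> [p hp||p hp]; rewrite ?tauk //; last first.
    by apply: contraNneq nc => <-; apply: map_f; rewrite mem_iota.
  rewrite /tau; have := ltn_modk p; case: ltngtP => // _ _.
  have [h1 h2] := in_windowP a (p %% k).
  by congr f; apply: (window_inj (w := a)); rewrite ?h2 ?modn_mod.
have [i1 i2 i3] := IH (ltnW mn).
set q := walk f a [::] m in i1 i2 i3 *; set w := a + m in i1 i3 *.
have -> : a + m.+1 = w.+1 by rewrite addnS.
have wk : w %% k < k by apply: ltn_modk.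
have wh : w + k < hi by lia.
have lw : lo <= w by lia.
case: (eqVneq (f w) (f (w + k))) => [fe|fn].
  split=> // p hp; case: (eqVneq p (w + k)) => pw.
  - by rewrite pw -fe modnDr i1 //; lia.
  - by apply: i1; lia.
  - by rewrite pw -fe i3 //; lia.
  - by apply: i3; lia.
have ek : f (w + k) = replay tau q k.
  have [x hx ex] := no_extra_color vf lw wh fn i2.
  case: (eqVneq x (w + k)) ex => [-> //|xk] ex.
  by have := i3 x; rewrite ex eqxx => /(_ ltac:(lia)).
have ew : f w = replay tau q (w %% k) by apply: i1; lia.
have rk : replay tau (push (w %% k) q) k = f w.
  by rewrite replay_push // /exchange eq_sym ltn_eqF // eqxx.
rewrite rk; split=> [p hp||p hp].
- rewrite replay_push // /exchange; case: (eqVneq p (w + k)) => [->|pw].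
    by rewrite modnDr eqxx.
  have -> : (p %% k == w %% k) = false.
    by rewrite eq_sym; apply/negbTE/modn_near; lia.
  by rewrite (ltn_eqF (ltn_modk p)) i1 //; lia.
- by apply: f1; lia.
case: (eqVneq p (w + k)) => [->|pw]; first by rewrite eq_sym.
by rewrite eq_sym f2 //; lia.
Qed.

Lemma walk_state f lo hi a i j p q : valid f lo hi -> lo <= a ->
  a + i + k <= hi -> a + j + k <= hi ->
  walk f a [::] i = walk f a [::] j ->
  a + i <= p < a + i + k -> a + j <= q < a + j + k -> p = q %[mod k] -> f p = f q.
Proof.
move=> vf la ih jh e hp hq pq.
have [tau h] := @replay_walk f lo hi a (maxn i j) vf la ltac:(lia).
have [-> // _ _] := h i (leq_maxl _ _); have [-> // _ _] := h j (leq_maxr _ _).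
by rewrite e pq.
Qed.

(** A walk from the root cannot reach a vertex without passing through all its ancestors. *)
Lemma walk_visits f a n x z : walk f a [::] n = x ++ z ->
  exists2 m, m <= n & walk f a [::] m = z.
Proof.
elim: n x => [|n IH] x /=.
  by case: x => //; case: z => // _; exists 0.
have st x' : walk f a [::] n = x' ++ z -> exists2 m, m <= n.+1 & walk f a [::] m = z.
  by case/IH => m mn e; exists m => //; apply: leqW.
case: ifP => [_ |ne]; first exact: st.
case: x => [|c x] /= e; first by exists n.+1 => //=; rewrite ne.
move: e; case e : (walk f a [::] n) => [|d s] /=.
  by case=> _; case: x => //= ez; apply: (st [::]); rewrite e -ez.
case: eqP => _.
  by move=> es; apply: (st [:: d, c & x]); rewrite e es.
by case=> _ es; apply: (st x); rewrite e.
Qed.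

Lemma walk_crosses f a n x c z : walk f a [::] n = x ++ c :: z ->
  exists m, [/\ m < n, walk f a [::] m = z & walk f a [::] m.+1 = c :: z].
Proof.
elim: n x => [|n IH] x; first by case: x.
have st x' : walk f a [::] n = x' ++ c :: z ->
    exists m, [/\ m < n.+1, walk f a [::] m = z & walk f a [::] m.+1 = c :: z].
  by case/IH => m [mn e e']; exists m; split=> //; apply: leqW.
move=> w1; move: (w1) => /=; case: ifP => [_ |ne]; first exact: st.
case e : (walk f a [::] n) => [|d s] /=.
  case: x w1 => [|b x] w1 [_]; last by case: (x).
  by move=> ez; exists n; split=> //; rewrite e.
case: eqP => _.
  by move=> es; apply: (st (d :: x)); rewrite e es.
case: x w1 => [|b x] w1 /= [_ es]; last by apply: (st x); rewrite e.
by exists n; split=> //; rewrite e es.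
Qed.

(** For even [L] there is one midpoint and [m' = m]; for odd [L] the middle edge is crossed in one
    step and [m' = m.+1]. That the two windows are neighbors matters in [shifted_conflict]. *)
Lemma walk_center f a n L : drift f a n = L ->
  exists m m', [/\ m' <= n, m' = m \/ m' = m.+1,
    size (walk f a [::] m) = L./2, size (walk f a [::] m') = uphalf L &
    (exists x, walk f a [::] n = x ++ walk f a [::] m) /\
    (exists x, walk f a [::] n = x ++ walk f a [::] m')].
Proof.
rewrite /drift; set s := walk f a [::] n => sL.
case oL : (odd L).
  have hL : uphalf L <= L by lia.
  have := cat_take_drop (L - uphalf L) s.
  case e : (drop _ s) => [|c z]; first by have := size_drop (L - uphalf L) s; rewrite e /=; lia.
  have sz := size_drop (L - uphalf L) s; rewrite e /= in sz.
  move=> /esym es; have [m [mn e1 e2]] := walk_crosses es.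
  exists m, m.+1; split=> //; [by right|by rewrite e1; lia|by rewrite e2 /=; lia|].
  rewrite e1 e2 -/s es; split; last by eexists.
  by exists (take (L - uphalf L) s ++ [:: c]); rewrite -catA.
have es := esym (cat_take_drop (L - L./2) s).
have [m mn e] := walk_visits es.
exists m, m; rewrite e size_drop sL; split=> //; [by left|by lia|by lia|].
by split; exists (take (L - L./2) s).
Qed.

(** * The metric of the tree and its midpoints *)

Lemma tdistC p q : tdist p q = tdist q p.
Proof. by rewrite /tdist lcaC addnC. Qed.

Lemma tdist_suffix x z : tdist z (x ++ z) = size x.
Proof. by rewrite /tdist lca_suffix size_cat; lia. Qed.

Lemma tdistE p q : tdist p q + (lca p q).*2 = size p + size q.
Proof. by rewrite /tdist; have := lca_size p q; have := lca_size q p; rewrite lcaC; lia. Qed.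

Lemma tdist_eq0 p q : tdist p q = 0 -> p = q.
Proof.
have := tdistE p q; have := lca_size p q; have := lca_size q p; rewrite lcaC => *.
by apply: lca_full; lia.
Qed.

Lemma tdist_root p : tdist [::] p = size p.
Proof. by rewrite /tdist /lca subn0. Qed.

Lemma tdist_triangle p q r : tdist p r <= tdist p q + tdist q r.
Proof.
have := lca_ultra p q r; have := lca_size q p; have := lca_size q r; rewrite (lcaC q p).
by have := tdistE p q; have := tdistE q r; have := tdistE p r; lia.
Qed.

Lemma lca_four_point x y z w :
  minn (lca x z + lca y w) (lca x w + lca y z) <= lca x y + lca z w.
Proof.
have xy1 := lca_ultra x z y; have xy2 := lca_ultra x w y.
have zw1 := lca_ultra z x w; have zw2 := lca_ultra z y w.
rewrite (lcaC z x) in zw1; rewrite (lcaC z y) in xy1 zw2; rewrite (lcaC w y) in xy2.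
rewrite !geq_min in xy1 xy2 zw1 zw2; rewrite geq_min.
by case/orP: xy1 => ?; case/orP: xy2 => ?; case/orP: zw1 => ?; case/orP: zw2 => ?; lia.
Qed.

(** The four point condition, characteristic of tree metrics. *)
Lemma tdist_four_point x y z w : 
  tdist x y + tdist z w <= maxn (tdist x z + tdist y w) (tdist x w + tdist y z).
Proof.
have := lca_four_point x y z w.
by have := tdistE x y; have := tdistE z w; have := tdistE x z; have := tdistE y w;
  have := tdistE x w; have := tdistE y z; lia.
Qed.

(** The four point condition on [y], [z], [m], [c] bounds [L + tdist m c] by [L]. *)
Lemma geodesic_point y z m c h L : tdist y z = L -> h <= L ->
  tdist y m = h -> tdist m z = L - h -> tdist y c = h -> tdist c z = L - h -> m = c.
Proof.
move=> yz hL ym mz yc cz; apply: tdist_eq0.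
by have := tdist_four_point y z m c; rewrite yz ym yc !(tdistC z) mz cz; lia.
Qed.

(* [m] is a center of the geodesic from the root to [b]; [c] and [c'] are the
   centers of the one from [y] to [z], distinct only for [L] odd. *)
Lemma common_center L b m y z c c' :
  size b = L -> size m = L./2 -> tdist m b = uphalf L ->
  size y <= L -> size z <= L -> tdist b y <= L -> tdist b z <= L ->
  tdist y z = L -> tdist y c = L./2 -> tdist c z = uphalf L ->
  tdist y c' = uphalf L -> tdist c' z = L./2 -> m = c \/ m = c'.
Proof.
move=> sb sm mb sy sz yb zb yz yc cz yc' cz'.
have h1 : tdist y m <= uphalf L.
  have := tdist_four_point [::] b y m.
  by rewrite !tdist_root (tdistC b m) mb sb sm; lia.
have h2 : tdist m z <= uphalf L.
  have := tdist_four_point [::] b z m.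
  by rewrite !tdist_root (tdistC b m) mb sb sm (tdistC m z); lia.
(* The sum is at least [L] and at most [L + 1]; a triangle in a tree has even perimeter, which rules
   out [L + 1]. *)
have h3 : tdist y m + tdist m z = L.
  have := tdist_triangle y m z; rewrite yz.
  by have := tdistE y m; have := tdistE m z; have := tdistE y z; lia.
case: (leqP (tdist y m) L./2) => h4.
  by left; apply: (geodesic_point yz (h := L./2)) => //; lia.
by right; apply: (geodesic_point yz (h := uphalf L)) => //; lia.
Qed.

(* The position of [f1] congruent to [off + x.+1] would have the color of both
   [x.+1] and [x], or of both [x.+1] and [x + k], in [f2]. *)
Lemma shifted_conflict (f1 f2 : nat -> nat) lo hi w off x y : valid f2 lo hi ->
  lo <= x -> lo <= y -> x + k <= hi -> y + k <= hi -> x <= y.+1 -> y <= x.+1 ->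
  (forall p q, w <= p < w + k -> x <= q < x + k ->
     p = off + q %[mod k] -> f1 p = f2 q) ->
  (forall p q, w <= p < w + k -> y <= q < y + k ->
     p = off.+1 + q %[mod k] -> f1 p = f2 q) -> False.
Proof.
move=> v lx ly xh yh xy yx h1 h2; have [_ v2] := validP _ _ _ v.
set p := in_window w (off + x.+1); have [hp ep] : w <= p < w + k /\ p = off + x.+1 %[mod k].
  exact: in_windowP.
have e1 : f1 p = f2 x.+1 by apply: h1 => //; lia.
case: (leqP y x) => yx'.
  have e2 : f1 p = f2 x by apply: h2 => //; [lia | rewrite ep; congr (_ %% k); lia].
  by have := v2 x x.+1; rewrite -e1 -e2 eqxx => /(_ ltac:(lia) ltac:(lia) ltac:(lia)).
have e2 : f1 p = f2 (x + k).
  by apply: h2 => //; [lia | rewrite ep addnA modnDr; congr (_ %% k); lia].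
by have := v2 x.+1 (x + k); rewrite -e1 -e2 eqxx => /(_ ltac:(lia) ltac:(lia) ltac:(lia)).
Qed.

(** [b] depends on [f1] and [f2] only: the adversary fixes the joint before the gap is colored. An
    invalid piece makes every extension invalid, and a piece with drift above [L] suffices by
    itself. If both drifts equal [L], [b] is chosen so that no center of the second piece matches
    the colors at the center of the first. *)
Lemma drift_merge f1 f2 lo hi1 hi2 off L :
  (valid f1 lo hi1 -> exists a n, [/\ lo <= a, a + n + k <= hi1 & L <= drift f1 a n]) ->
  (valid f2 lo hi2 -> exists a n, [/\ lo <= a, a + n + k <= hi2 & L <= drift f2 a n]) ->
  hi1 <= off ->
  exists b : bool, forall f, valid f lo (off + b + hi2) ->
    (forall x, lo <= x < hi1 -> f x = f1 x) ->
    (forall x, lo <= x < hi2 -> f (off + b + x) = f2 x) ->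
    exists a n, [/\ lo <= a, a + n + k <= off + b + hi2 & L < drift f a n].
Proof.
move=> H1 H2 ho.
case: (boolP (valid f1 lo hi1)) => [v1|nv1]; last first.
  exists false => f v e1 _; case/negP: nv1; apply: eq_valid e1 _.
  by apply: valid_sub v _ _; lia.
case: (boolP (valid f2 lo hi2)) => [v2|nv2]; last first.
  exists false => f v _ e2; case/negP: nv2; apply: eq_valid e2 _.
  by apply: valid_shift; apply: valid_sub v _ _; lia.
have [a1 [n1 [la1 ah1 d1]]] := H1 v1; have [a2 [n2 [la2 ah2 d2]]] := H2 v2.
have tr1 f a n : (forall x, lo <= x < hi1 -> f x = f1 x) ->
    lo <= a -> a + n + k <= hi1 -> walk f a [::] n = walk f1 a [::] n.
  by move=> e la ah; apply: eq_walk => x hx; apply: e; lia.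
have tr2 f (b : bool) a n : (forall x, lo <= x < hi2 -> f (off + b + x) = f2 x) ->
    lo <= a -> a + n + k <= hi2 -> drift f (off + b + a) n = drift f2 a n.
  move=> e la ah; rewrite -drift_shift /drift (@eq_walk _ f2) // => x hx.
  by apply: e; lia.
case: (ltngtP L (drift f1 a1 n1)) d1 => // [d1 _|d1 _].
  exists false => f v e1 e2; exists a1, n1; split=> //; first by lia.
  by rewrite /drift (tr1 f).
case: (ltngtP L (drift f2 a2 n2)) d2 => // [d2 _|d2 _].
  exists false => f v e1 e2; exists (off + 0 + a2), n2; split; [by lia|by lia|].
  by rewrite (tr2 f false).
have [m1 [m1' [m1n m1m sm1 _ [[x1 ex1] _]]]] := walk_center (esym d1).
have [m2 [m2' [m2n m2m sm2 sm2' [[x2 ex2] [x2' ex2']]]]] := walk_center (esym d2).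
have [b nc] : exists b : bool, forall m, m = m2 \/ m = m2' ->
    ~ forall p q, a1 + m1 <= p < a1 + m1 + k -> a2 + m <= q < a2 + m + k ->
        p = off + b + q %[mod k] -> f1 p = f2 q.
  (* A conflict is a finite check, hence decidable; [shifted_conflict] excludes one for both values
     of [b]. *)
  pose conflict c := has (fun m => all (fun p => all (fun q =>
    (p == off + c + q %[mod k]) ==> (f1 p == f2 q)) (iota (a2 + m) k))
    (iota (a1 + m1) k)) [:: m2; m2'].
  have cP c : reflect (exists2 m, m = m2 \/ m = m2' &
      forall p q, a1 + m1 <= p < a1 + m1 + k -> a2 + m <= q < a2 + m + k ->
      p = off + c + q %[mod k] -> f1 p = f2 q) (conflict c).
    apply: (iffP hasP) => -[m hm h]; exists m.
    - by move: hm; rewrite !inE => /orP[] /eqP; [left | right].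
    - move=> p q hp hq e; have /allP/(_ p) := h; rewrite mem_iota => /(_ hp)/allP/(_ q).
      by rewrite mem_iota e eqxx => /(_ hq)/eqP.
    - by rewrite !inE; case: hm => ->; rewrite eqxx ?orbT.
    apply/allP => p; rewrite mem_iota => hp; apply/allP => q; rewrite mem_iota => hq.
    by apply/implyP => /eqP pq; apply/eqP; apply: h.
  case: (cP 0) => [[x hx h1]|n0]; last by exists false => m hm h; apply: n0; exists m.
  exists true => y hy h2.
  apply: (@shifted_conflict f1 f2 lo hi2 (a1 + m1) off (a2 + x) (a2 + y)) => //;
    try (by move: hx hy m2n m2m la2 ah2; clear; lia).
  - by move=> p q hp hq e; apply: h1; rewrite ?addn0.
  - by move=> p q hp hq e; apply: h2; rewrite ?addn1.
exists b => f v e1 e2.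
(* After [s0] steps, the walk started at [a1] reaches the first window of the second walk. *)
pose s0 := off + b + a2 - a1; pose W := walk f a1 [::].
have es0 : a1 + s0 = off + b + a2 by rewrite /s0; lia.
have dW i j : i <= j -> tdist (W i) (W j) = drift f (a1 + i) (j - i) by apply: drift_between.
have W1 i : i <= n1 -> W i = walk f1 a1 [::] i by move=> ?; apply: (tr1 f) => //; lia.
have dW2 i j : i <= j -> j <= n2 -> tdist (W (s0 + i)) (W (s0 + j)) =
    tdist (walk f2 a2 [::] i) (walk f2 a2 [::] j).
  move=> ij jn; rewrite dW ?leq_add2l // drift_between // addnA es0 subnDl -addnA.
  by apply: tr2 => //; move: ij jn la2 ah2; clear; lia.
(* Four distances between ends of the two walks: one above [L] proves the claim, otherwise
   [common_center] applies. *)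
case: (leqP (size (W s0)) L) => c1; last first.
  by exists a1, s0; split=> //; rewrite es0; clear -ah2; lia.
case: (leqP (size (W (s0 + n2))) L) => c2; last first.
  by exists a1, (s0 + n2); split=> //; rewrite addnA es0; clear -ah2; lia.
have n1s : n1 <= s0 by rewrite /s0; lia.
case: (leqP (tdist (W n1) (W s0)) L) => c3; last first.
  exists (a1 + n1), (s0 - n1); rewrite -dW //; split=> //; last by clear -es0 ah2 n1s; lia.
  by clear -la1; lia.
case: (leqP (tdist (W n1) (W (s0 + n2))) L) => c4; last first.
  have n1t : n1 <= s0 + n2 by apply: leq_trans n1s (leq_addr _ _).
  exists (a1 + n1), (s0 + n2 - n1); rewrite -dW //; split=> //; last by clear -es0 ah2 n1t; lia.
  by clear -la1; lia.
exfalso.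
have sd2 m x : walk f2 a2 [::] n2 = x ++ walk f2 a2 [::] m -> m <= n2 ->
    tdist (W (s0 + m)) (W (s0 + n2)) = L - size (walk f2 a2 [::] m).
  by move=> e mn; rewrite dW2 // d2 /drift e tdist_suffix size_cat addnK.
have sd1 m : m <= n2 -> tdist (W s0) (W (s0 + m)) = size (walk f2 a2 [::] m).
  by move=> mn; have := dW2 0 m (leq0n m) mn; rewrite addn0 tdist_root.
have m2n2 : m2 <= n2 by lia.
have hM : W m1 = W (s0 + m2) \/ W m1 = W (s0 + m2').
  have m1n1 : m1 <= n1 by lia.
  apply: (@common_center L (W n1) (W m1) (W s0) (W (s0 + n2))) => //.
  - by rewrite W1.
  - by rewrite W1.
  - by rewrite !W1 // ex1 tdist_suffix; move: d1; rewrite /drift ex1 size_cat; lia.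
  - by rewrite sd1 // d2.
  - by rewrite sd1.
  - by rewrite (sd2 _ _ ex2) // sm2; lia.
  - by rewrite sd1.
  - by rewrite (sd2 _ _ ex2') // sm2'; lia.
have [m hm eM] : exists2 m, m = m2 \/ m = m2' & W m1 = W (s0 + m).
  by case: hM => e; [exists m2|exists m2'] => //; [left|right].
(* Equal tree vertices force equal colors, against the choice of [b]. *)
apply: (nc m hm) => p q hp hq pq; rewrite -e1 -?e2.
- apply: (walk_state v la1 _ _ eM) => //; try (by move: hq es0; clear; lia).
  + by move: m1n m1m ah1 ho; clear; lia.
  + by move: hm es0 m2n m2m ah2; clear; lia.
- by move: hq hm m2n m2m la2 ah2; clear; lia.
by move: hp la1 m1n m1m ah1; clear; lia.
Qed.

End Walk.

(** * The adaptive adversary *)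

Section View.
Variables (n M T : nat) (id : 'I_n -> 'I_M) (A : view M -> nat).
Implicit Types (e : rel 'I_n) (s : seq 'I_n).

Lemma in_nbhd e (S : {set 'I_n}) y :
  (y \in nbhd e S) = (y \in S) || [exists x in S, e x y].
Proof. by rewrite !inE. Qed.

(* [Q t] bounds the ball of radius [t] around the presented vertices. *)
Lemma online_coloring_local e1 e2 s r v (Q : nat -> pred 'I_n) :
  v \in s -> {in s, forall x, Q 0 x} ->
  (forall t x, t < T -> Q t x -> Q t.+1 x) ->
  (forall t x y, t < T -> Q t x -> e1 x y -> Q t.+1 y) ->
  (forall x y, Q T x -> e1 x y = e2 x y) ->
  online_coloring e1 id s T A v = online_coloring e2 id (s ++ r) T A v.
Proof.
move=> vs Q0 QS Qe Qeq.
have QT t d x : t + d = T -> Q t x -> Q T x.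
  elim: d t => [|d IH] t; first by rewrite addn0 => ->.
  by move=> e q; apply: (IH t.+1); [lia|apply: QS; [lia|]].
rewrite /online_coloring index_cat vs; congr A.
have lt : index v s < size s by rewrite index_mem.
have tk : take (index v s).+1 (s ++ r) = take (index v s).+1 s.
  rewrite take_cat; case: ltngtP => // [h|->]; first by lia.
  by rewrite subnn take0 cats0 take_size.
rewrite /online_view tk; set P := take _ s.
have hb t : t <= T -> ball e1 [set x in P] t = ball e2 [set x in P] t /\
    forall x, x \in ball e1 [set x in P] t -> Q t x.
  elim: t => [|t IH] tT.
    by split=> // x; rewrite inE => /mem_take; apply: Q0.
  have [E h] := IH (ltnW tT).
  rewrite /ball !iterS -!/(ball _ _ _) -E; split.
    apply/setP => y; rewrite !in_nbhd; congr (_ || _).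
    apply: eq_existsb => x; case: (boolP (x \in ball _ _ _)) => //= xb.
    by rewrite Qeq //; apply: (QT t (T - t)); [lia | apply: h].
  move=> y; rewrite in_nbhd => /orP[yb|/existsP[x /andP[xb xy]]].
    by apply: QS => //; apply: h.
  by apply: Qe xy => //; apply: h.
have [<- h] := hb T (leqnn T); congr (_, _, _).
apply/setP => z; apply/imset2P/imset2P => -[x y xU yU ->];
  exists x y => //; move: yU; rewrite !inE => /andP[-> xy] /=.
  by rewrite -Qeq // h.
by rewrite Qeq // h.
Qed.

End View.

Section Adversary.
Variables (n M k T H W : nat) (id : 'I_n -> 'I_M) (A : view M -> nat) (v0 : 'I_n).
Hypotheses (hk : 2 <= k) (hH : 0 < H) (hW : H * W <= n).
Implicit Types (e : rel 'I_n) (s : seq 'I_n) (x y v : 'I_n) (arr : seq nat).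

(** A column is only a label; its position is settled later by [arr], which lets the adversary
    postpone the joints. *)
Definition column x : nat := x %/ H.
Definition level x : nat := x %% H.
Definition vertex (c h : nat) : 'I_n := insubd v0 (c * H + h).

Lemma val_vertex c h : c < W -> h < H -> vertex c h = c * H + h :> nat.
Proof.
move=> cW hh; rewrite /vertex insubdK // unfold_in.
apply: leq_trans hW; rewrite (mulnC H); apply: leq_trans (leq_mul cW (leqnn H)).
by rewrite mulSn addnC ltn_add2r.
Qed.

Lemma column_vertex c h : c < W -> h < H -> column (vertex c h) = c.
Proof. by move=> cW hh; rewrite /column val_vertex // divnMDl // divn_small // addn0. Qed.

Lemma level_vertex c h : c < W -> h < H -> level (vertex c h) = h.
Proof. by move=> cW hh; rewrite /level val_vertex // modnMDl modn_small. Qed.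

Lemma vertexK x : column x < W -> vertex (column x) (level x) = x.
Proof.
move=> xW; apply: val_inj; rewrite /= val_vertex ?ltn_mod //.
by rewrite /column /level -divn_eq.
Qed.

(* [arr] lists the columns of a piece of the strip from left to right. *)
Definition pos arr x := index (column x) arr.

Definition strip arr : rel 'I_n := fun x y =>
  [&& column x \in arr, column y \in arr,
      level x <= (level y).+1, level y <= (level x).+1,
      pos arr x != pos arr y, pos arr x < pos arr y + k & pos arr y < pos arr x + k].

Definition block o w x := o <= column x < o + w.

(* The two pieces are either adjacent or separated by the spare column. *)
Definition juxtapose (b : bool) (c : nat) arr1 arr2 :=
  arr1 ++ (if b then c :: arr2 else rcons arr2 c).

(** * Joining two pieces *)

Section Juxtapose.
Variables (b : bool) (o w : nat) (arr1 arr2 : seq nat).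
Hypotheses (p1 : perm_eq arr1 (iota o w)) (p2 : perm_eq arr2 (iota (o + w) w)).
Let sl := o + w + w.
Let arr := juxtapose b sl arr1 arr2.

Let c1 c : (c \in arr1) = (o <= c < o + w).
Proof. by rewrite (perm_mem p1) mem_iota. Qed.
Let c2 c : (c \in arr2) = (o + w <= c < o + w + w).
Proof. by rewrite (perm_mem p2) mem_iota. Qed.
Let s1 : size arr1 = w. Proof. by rewrite (perm_size p1) size_iota. Qed.
Let s2 : size arr2 = w. Proof. by rewrite (perm_size p2) size_iota. Qed.

Lemma mem_juxtapose c : (c \in arr) = (o <= c < o + (w + w.+1)).
Proof.
rewrite mem_cat c1 (_ : c \in _ = (c == sl) || (c \in arr2)); last first.
  by case: (b); rewrite ?inE ?mem_rcons ?inE.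
by rewrite c2 /sl; clear; lia.
Qed.

Lemma perm_juxtapose : perm_eq arr (iota o (w + w.+1)).
Proof.
rewrite iotaD; apply: perm_cat => //.
rewrite -addn1 iotaD; case: (b); last by rewrite -cats1 perm_cat.
by rewrite perm_sym perm_catC /= perm_cons perm_sym.
Qed.

Lemma pos_juxtapose1 x : column x \in arr1 -> pos arr x = pos arr1 x.
Proof. by move=> xa; rewrite /pos index_cat xa. Qed.

Lemma pos_juxtapose2 x : column x \in arr2 -> pos arr x = w + b + pos arr2 x.
Proof.
move=> xa; have nx1 : column x \in arr1 = false by move: xa; rewrite c1 c2; clear; lia.
rewrite /pos index_cat nx1 s1; case: (b) => /=; last first.
  by rewrite -cats1 index_cat xa addn0.
have -> : (sl == column x) = false by move: xa; rewrite c2 /sl; clear; lia.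
by rewrite -addnA add1n.
Qed.

Lemma pos_juxtapose_spare x : column x = sl -> pos arr x = if b then w else w + w.
Proof.
move=> xa; have nx1 : sl \in arr1 = false by rewrite c1 /sl; clear; lia.
have nx2 : sl \in arr2 = false by rewrite c2 /sl; clear; lia.
rewrite /pos xa index_cat nx1 s1; case: (b) => /=; first by rewrite eqxx addn0.
by rewrite -cats1 index_cat nx2 s2 /= eqxx addn0.
Qed.

Lemma nth_juxtapose2 p : p < w -> nth 0 arr (w + b + p) = nth 0 arr2 p.
Proof.
move=> pw; rewrite nth_cat s1 -addnA ltnNge leq_addr /= addKn.
by case: (b) => //; rewrite nth_rcons s2 add0n pw.
Qed.

Lemma pos_piece1 x : column x \in arr1 -> pos arr1 x < w.
Proof. by rewrite -s1 index_mem. Qed.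

Lemma pos_piece2 x : column x \in arr2 -> pos arr2 x < w.
Proof. by rewrite -s2 index_mem. Qed.

(** Edges join positions less than [k] apart, so a vertex [k] away from the ends that meet new
    columns keeps its neighbors. The second piece may meet the spare column on its right, hence a
    bound on both its sides. *)
Lemma strip_juxtapose x y :
  [|| ~~ block o (w + w.+1) x, block o w x && (pos arr1 x + k <= w) |
      [&& block (o + w) w x, pos arr2 x + k <= w & k <= pos arr2 x]] ->
  strip arr1 x y || strip arr2 x y = strip arr x y.
Proof.
have cy : [|| column y == sl, column y \in arr1 | column y \in arr2] = (column y \in arr).
  by rewrite mem_juxtapose c1 c2 /sl; clear; lia.
rewrite {1 2 3}/block /strip -!c1 -!c2 -mem_juxtapose.
case/or3P => [nx|/andP[x1 xh]|/and3P[x2 xh xm]].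
- have : column x \in arr1 = false by move: nx; rewrite mem_juxtapose c1; clear; lia.
  have : column x \in arr2 = false by move: nx; rewrite mem_juxtapose c2; clear; lia.
  by move=> -> ->; rewrite (negbTE nx).
- have -> : column x \in arr2 = false by move: x1; rewrite c1 c2; clear; lia.
  have -> : column x \in arr by move: x1; rewrite c1 mem_juxtapose; clear; lia.
  rewrite x1 orbF (pos_juxtapose1 x1); case: (boolP (column y \in arr1)) => y1.
    by rewrite (pos_juxtapose1 y1) -cy y1 orbT.
  rewrite -cy (negbTE y1) /=; case: eqP => [ys|_] /=.
    rewrite (pos_juxtapose_spare ys); apply/esym/negbTE/negP => /and5P[_ _ _ _].
    by move: xh; clear; case: (b); lia.
  case: (boolP (_ \in _)) => //= y2; rewrite (pos_juxtapose2 y2).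
  by apply/esym/negbTE/negP => /and5P[_ _ _ _]; move: xh; clear; lia.
have -> : column x \in arr1 = false by move: x2; rewrite c1 c2; clear; lia.
have -> : column x \in arr by move: x2; rewrite c2 mem_juxtapose; clear; lia.
rewrite x2 (pos_juxtapose2 x2) /=; case: (boolP (column y \in arr2)) => y2.
  rewrite (pos_juxtapose2 y2) -cy y2 !orbT eqn_add2l -!addnA !ltn_add2l.
  by [].
rewrite -cy (negbTE y2) orbF /=; case: eqP => [ys|_] /=.
  rewrite (pos_juxtapose_spare ys); apply/esym/negbTE/negP => /and5P[_ _ _].
  by move: xh xm; clear; case: (b); lia.
case: (boolP (_ \in _)) => //= y1; rewrite (pos_juxtapose1 y1).
apply/esym/negbTE/negP => /and5P[_ _ _].
by move: xh xm (pos_piece1 y1); clear; lia.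
Qed.

End Juxtapose.

(** A ball of radius [T] spreads by less than [k] positions per step, and its outermost vertices
    need [k] more for [strip_juxtapose]. *)
Definition margin := T.+1 * k.

(** Two pieces and the spare column; at the bottom, one window between two margins. *)
Fixpoint width (l : nat) := if l is l'.+1 then (width l').*2.+1 else (margin.*2 + k).

(** The graph [e0] and the history [s0] are arbitrary outside the block, since the second piece is
    played after the first. Only row 0 is presented, at positions from [margin] to [hi - 1], so that
    the ends of the piece stay out of sight. *)
Lemma adversary l o e0 s0 :
  o + width l <= W ->
  (forall x y, e0 x y -> ~~ block o (width l) x && ~~ block o (width l) y) ->
  {in s0, forall x, ~~ block o (width l) x} ->
  exists arr hi ord,
  [/\ perm_eq arr (iota o (width l)), (margin <= hi) && (hi + margin <= width l), uniq ord,
      forall x, (x \in ord) =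
        [&& block o (width l) x, level x == 0 & margin <= pos arr x < hi] &
      let f p := online_coloring (fun x y => e0 x y || strip arr x y) id
                   (s0 ++ ord) T A (vertex (nth 0 arr p) 0) in
      valid k f margin hi ->
      exists a m, [/\ margin <= a, a + m + k <= hi & l <= drift k f a m]].
Proof.
elim: l o e0 s0 => [|l IH] o e0 s0 oW he0 hs0.
  exists (iota o (width 0)), (margin + k),
    [seq x <- enum 'I_n | [&& block o (width 0) x, level x == 0 &
       margin <= pos (iota o (width 0)) x < margin + k]].
  split=> //=; first by lia.
  - by rewrite filter_uniq ?enum_uniq.
  - by move=> x; rewrite mem_filter mem_enum andbT.
  by move=> _; exists margin, 0; rewrite addn0; split.
set w := width l in IH; have ew : width l.+1 = w + w.+1 by rewrite /= -/w; clear; lia.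
rewrite ew in oW he0 hs0 *.
have ow : o + w <= W by move: oW; clear; lia.
have oww : o + w + w <= W by move: oW; clear; lia.
have sub1 x : ~~ block o (w + w.+1) x -> ~~ block o w x.
  by rewrite /block; clear; lia.
have sub2 x : ~~ block o (w + w.+1) x -> ~~ block (o + w) w x.
  by rewrite /block; clear; lia.
have dis x : block o w x -> ~~ block (o + w) w x.
  by rewrite /block; clear; lia.
have [||arr1 [hi1 [ord1 [p1 b1 u1 m1]]]] := IH o e0 s0 ow.
- by move=> x y /he0/andP[/sub1-> /sub1->].
- by move=> x /hs0/sub1.
set f1 := fun p => _ => /= H1.
have c1 c : (c \in arr1) = (o <= c < o + w) by rewrite (perm_mem p1) mem_iota.
set e1 := (fun x y => e0 x y || strip arr1 x y) in f1 H1.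
have [||arr2 [hi2 [ord2 [p2 b2 u2 m2]]]] := IH (o + w) e1 (s0 ++ ord1) oww.
- move=> x y /orP[/he0/andP[/sub2-> /sub2->//]|].
  by case/and3P; rewrite !c1 => /dis-> /dis->.
- by move=> x; rewrite mem_cat m1 => /orP[/hs0/sub2|/andP[/dis]].
set f2 := fun p => _ => /= H2.
have c2 c : (c \in arr2) = (o + w <= c < o + w + w) by rewrite (perm_mem p2) mem_iota.
set e2 := (fun x y => e1 x y || strip arr2 x y) in f2 H2.
have s1 : size arr1 = w by rewrite (perm_size p1) size_iota.
have s2 : size arr2 = w by rewrite (perm_size p2) size_iota.
have ua1 : uniq arr1 by rewrite (perm_uniq p1) iota_uniq.
have ua2 : uniq arr2 by rewrite (perm_uniq p2) iota_uniq.
have hi1w : hi1 <= w by move: b1; clear; lia.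
have [b Hb] := drift_merge hk H1 H2 hi1w.
pose arr := juxtapose b (o + w + w) arr1 arr2.
have carr := mem_juxtapose b p1 p2.
have pos1 := @pos_juxtapose1 b o w arr1 arr2.
have pos2 := pos_juxtapose2 b p1 p2.
have posl := pos_juxtapose_spare b p1 p2.
have bd1 := pos_piece1 p1; have bd2 := pos_piece2 p2.
rewrite -/arr in carr pos1 pos2 posl.
(* Row 0 between the two presented ranges comes last, once the joint is fixed. *)
pose gap := [seq x <- enum 'I_n | [&& block o (w + w.+1) x, level x == 0 &
  hi1 <= pos arr x < w + b + margin]].
pose e' := fun x y => e0 x y || strip arr x y.
exists arr, (w + b + hi2), (ord1 ++ ord2 ++ gap); split.
- exact: perm_juxtapose.
- by move: b2; clear; case: (b); lia.
- rewrite !cat_uniq u1 u2 filter_uniq ?enum_uniq //= andbT.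
  apply/andP; split; apply/hasPn => x.
    rewrite mem_cat m2 mem_filter m1 => /orP[/andP[xb _]|].
      by apply/negP => /andP[/dis]; rewrite xb.
    case/andP=> /and3P[_ _ h] _; apply/negP => /and3P[xb _ h2].
    by move: h h2; rewrite pos1 ?c1 //; clear; lia.
  rewrite mem_filter m2 => /andP[/and3P[_ _ h] _]; apply/negP => /and3P[xb _ h2].
  by move: h h2; rewrite pos2 ?c2 //; clear; lia.
- move=> x; rewrite !mem_cat m1 m2 mem_filter mem_enum andbT.
  case: (level x == 0); rewrite ?andbF //= ?andbT.
  case: (boolP (block o w x)) => x1 /=.
    have xb : column x \in arr1 by rewrite c1.
    rewrite (negbTE (dis _ x1)) /= (_ : block o (w + w.+1) x); last first.
      by apply: contraLR x1 => /sub1.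
    by move: b1 b2 (bd1 x xb); rewrite (pos1 _ xb); clear; lia.
  case: (boolP (block (o + w) w x)) => x2 /=.
    have xb : column x \in arr2 by rewrite c2.
    rewrite (_ : block o (w + w.+1) x); last by apply: contraLR x2 => /sub2.
    by move: b1 b2 (bd2 x xb); rewrite (pos2 _ xb); clear; lia.
  case: (boolP (block o _ x)) => //= x3.
  have xs : column x = o + w + w by move: x1 x2 x3; rewrite /block; clear; lia.
  by move: b1 b2; rewrite (posl _ xs); clear; case: (b); lia.
(* The balls seen so far avoid the second block, so its edges do not change the colors already
   given. *)
pose Q1 (t : nat) x := ~~ block (o + w) w x.
have E1 v : v \in s0 ++ ord1 ->
    online_coloring e1 id (s0 ++ ord1) T A v =
    online_coloring e2 id ((s0 ++ ord1) ++ ord2) T A v.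
  move=> vs; apply: (@online_coloring_local _ _ _ _ _ _ _ _ _ _ Q1) => //.
  - by move=> x; rewrite mem_cat m1 => /orP[/hs0/sub2|/andP[/dis]].
  - move=> t x y _ _ /orP[/he0/andP[_ /sub2]//|].
    by case/and3P => _; rewrite c1 => /dis.
  - by move=> x y; rewrite /Q1 /e2 /strip c2 => /negbTE; rewrite /block => ->; rewrite orbF.
(* The presented ranges grow by [k] positions per step; after [T] steps [strip_juxtapose] still
   applies, so the joint is invisible. *)
pose Q2 t x := [|| ~~ block o (w + w.+1) x,
  block o w x && (pos arr1 x < hi1 + t * k) |
  [&& block (o + w) w x, pos arr2 x < hi2 + t * k & margin <= pos arr2 x + t * k]].
have E2 v : v \in (s0 ++ ord1) ++ ord2 ->
    online_coloring e2 id ((s0 ++ ord1) ++ ord2) T A v =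
    online_coloring e' id (((s0 ++ ord1) ++ ord2) ++ gap) T A v.
  move=> vs; apply: (@online_coloring_local _ _ _ _ _ _ _ _ _ _ Q2) => //.
  - move=> x; rewrite !mem_cat m1 m2 /Q2 => /orP[/orP[/hs0->//|]|].
      by case/and3P=> -> _ /andP[_ h]; rewrite !mul0n !addn0 h orbT.
    by case/and3P=> -> _ /andP[h h']; rewrite !mul0n !addn0 h h' !orbT.
  - move=> t x _; rewrite /Q2 mulSn; clear.
    by case: (~~ block _ _ _) => //=; case: (block _ _ _); case: (block _ _ _); lia.
  - move=> t x y tT; rewrite /Q2 mulSn => Qx /orP[/orP[/he0/andP[_ yb]|]|]; first by rewrite yb.
    + case/and5P; rewrite !c1 => xb yb _ _ /and3P[_ _ h].
      move: Qx; rewrite (negbTE (dis _ xb)) (negbTE (dis _ yb)).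
      rewrite -/(block o w x) in xb; rewrite -/(block o w y) in yb.
      rewrite xb yb (_ : block o (w + w.+1) x) /=; last by apply: contraLR xb => /sub1.
      by rewrite !orbF => {}Qx; apply/orP; right; move: Qx h; clear; lia.
    case/and5P; rewrite !c2 => xb yb _ _ /and3P[_ h h'].
    have nd z : block (o + w) w z -> ~~ block o w z by apply: contraL => /dis.
    move: Qx; rewrite (negbTE (nd _ xb)) (negbTE (nd _ yb)).
    rewrite -/(block (o + w) w x) in xb; rewrite -/(block (o + w) w y) in yb.
    rewrite xb yb (_ : block o (w + w.+1) x) /=; last by apply: contraLR xb => /sub2.
    by move=> {}Qx; apply/orP; right; move: Qx h h'; clear; lia.
  move=> x y Qx; rewrite /e2 /e1 /e' -orbA; congr (_ || _).
  apply: (strip_juxtapose b p1 p2).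
  have Tk : T * k + k = margin by rewrite /margin mulSn addnC.
  move: Qx b1 b2 Tk; rewrite /Q2; case: (~~ block _ _ _) => //=.
  by case: (block _ _ _); case: (block _ _ _) => /=; clear; lia.
move=> v; apply: Hb v _ _.
- move=> x hx; have xw : x < w by move: hx b1; clear; lia.
  rewrite /f1 /arr nth_cat s1 xw.
  have vo : vertex (nth 0 arr1 x) 0 \in ord1.
    have xs : x < size arr1 by rewrite s1.
    have hc : o <= nth 0 arr1 x < o + w by rewrite -c1 mem_nth.
    have cW : nth 0 arr1 x < W by move: hc ow; clear; lia.
    by rewrite m1 /block /pos column_vertex ?level_vertex ?index_uniq ?hc.
  rewrite E1 ?mem_cat ?vo ?orbT // E2 ?mem_cat ?vo ?orbT //.
  by rewrite -!catA.
- move=> x hx; have xw : x < w by move: hx b2; clear; lia.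
  rewrite /f2 /arr (nth_juxtapose2 b p1 p2 xw).
  have vo : vertex (nth 0 arr2 x) 0 \in ord2.
    have xs : x < size arr2 by rewrite s2.
    have hc : o + w <= nth 0 arr2 x < o + w + w by rewrite -c2 mem_nth.
    have cW : nth 0 arr2 x < W by move: hc oww; clear; lia.
    by rewrite m2 /block /pos column_vertex ?level_vertex ?index_uniq ?hc.
  rewrite E2 ?mem_cat ?vo ?orbT //.
  by rewrite -!catA.
Qed.

End Adversary.

(** * The strip and its hubs *)

Section Cone.
Variables (n k H W : nat) (v0 : 'I_n) (arr : seq nat).
Hypotheses (hk : 2 <= k) (hH : 0 < H) (kW : k <= W) (hn : H * W + k <= n).
Hypothesis arrP : perm_eq arr (iota 0 W).
Implicit Types x y z : 'I_n.

Local Notation column := (@column n H).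
Local Notation level := (@level n H).
Local Notation pos := (@pos n H arr).
Local Notation vertex := (@vertex n H v0).

Let hHW : H * W <= n. Proof. by lia. Qed.

Definition hub x := W <= column x.
Definition height x := if hub x then H else level x.
(* All hubs beyond the first [k] are duplicates of hub [0]. *)
Definition residue x :=
  if hub x then (if x - H * W < k then x - H * W else 0) else pos x %% k.

(** Between positions less than [k] apart, residues differ exactly when positions do, so off the
    hubs this is [strip]. *)
Definition cone : rel 'I_n := fun x y =>
  [&& residue x != residue y, height x <= (height y).+1, height y <= (height x).+1
    & [|| hub x, hub y | (pos x < pos y + k) && (pos y < pos x + k)]].

(** Row [H] is read as a [k]-periodic row of hubs, so that hubs and strip rows are handled alike. *)
Definition site h p : 'I_n :=
  if h < H then vertex (nth 0 arr p) h else insubd v0 (H * W + p %% k).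

Lemma hubE x : hub x = (H * W <= x).
Proof. by rewrite /hub /column leq_divRL // mulnC. Qed.

Lemma nth_arr p : p < W -> nth 0 arr p < W.
Proof.
move=> pW; have ps : p < size arr by rewrite (perm_size arrP) size_iota.
have : 0 <= nth 0 arr p < 0 + W by rewrite -mem_iota -(perm_mem arrP) mem_nth.
by rewrite add0n.
Qed.

Lemma mem_arr x : (column x \in arr) = ~~ hub x.
Proof. by rewrite (perm_mem arrP) mem_iota /= add0n ltnNge. Qed.

Lemma pos_lt x : ~~ hub x -> pos x < W.
Proof. by rewrite -mem_arr -index_mem (perm_size arrP) size_iota. Qed.

Lemma level_lt x : level x < H.
Proof. by rewrite ltn_mod. Qed.

Lemma site_low h p : h < H -> p < W ->
  [/\ ~~ hub (site h p), height (site h p) = h, pos (site h p) = p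
    & residue (site h p) = p %% k].
Proof.
move=> hh pW; rewrite /residue /height /hub /site hh /pos.
have nW := nth_arr pW; have wn : (W <= nth 0 arr p) = false by rewrite leqNgt nW.
rewrite (column_vertex v0 hH hHW) // (level_vertex v0 hHW) // wn /=.
by rewrite index_uniq // ?(perm_size arrP) ?size_iota // (perm_uniq arrP) iota_uniq.
Qed.

Lemma site_top p :
  [/\ hub (site H p), height (site H p) = H & residue (site H p) = p %% k].
Proof.
have pk := ltn_modk hk p.
have e : site H p = H * W + p %% k :> nat.
  by rewrite /site ltnn insubdK // unfold_in; lia.
have hx : hub (site H p) by rewrite hubE e; lia.
by rewrite /residue /height hx e addKn pk.
Qed.

Lemma residue_site h p : h <= H -> p < W -> residue (site h p) = p %% k.
Proof.
rewrite leq_eqVlt => /orP[/eqP-> _|hh pW]; first by have [] := site_top p.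
by have [] := site_low hh pW.
Qed.

Lemma height_site h p : h <= H -> p < W -> height (site h p) = h.
Proof.
rewrite leq_eqVlt => /orP[/eqP-> _|hh pW]; first by have [] := site_top p.
by have [] := site_low hh pW.
Qed.

Lemma low_site x : ~~ hub x -> x = site (level x) (pos x).
Proof.
move=> nx; rewrite /site level_lt nth_index ?mem_arr //.
by rewrite (vertexK v0 hH hHW) // ltnNge.
Qed.

Lemma residue_lt x : residue x < k.
Proof. by rewrite /residue; case: ifP => _; [case: ifP => // _; lia | apply: ltn_modk]. Qed.

Lemma cone_site h h' p q : h <= H -> h' <= H -> h <= h'.+1 -> h' <= h.+1 ->
  p < W -> q < W -> p != q -> p < q + k -> q < p + k ->
  cone (site h p) (site h' q).
Proof.
move=> hh hh' d d' pW qW pq p1 q1.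
rewrite /cone !residue_site // modn_neq // !height_site // d d' /=.
case: (eqVneq h H) => [->|nh]; first by have [->] := site_top p.
case: (eqVneq h' H) => [->|nh']; first by have [-> _ _] := site_top q; rewrite orbT.
have [_ _ -> _] := @site_low h p ltac:(lia) pW.
have [_ _ -> _] := @site_low h' q ltac:(lia) qW.
by rewrite p1 q1 !orbT.
Qed.

Lemma cone_strip x y : ~~ hub x -> (level x).+1 < H -> strip k H arr x y = cone x y.
Proof.
move=> hx lx; rewrite /strip /cone !mem_arr hx /residue /height (negbTE hx) /=.
case: (boolP (hub y)) => hy /=.
  by rewrite [H <= _]leqNgt lx !andbF.
case: (eqVneq (pos x) (pos y)) => [->|ne]; first by rewrite eqxx !andbF.
case: (ltnP (pos x) _) => xy; case: (ltnP (pos y) _) => yx; rewrite ?andbF //=.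
by rewrite modn_neq.
Qed.

Lemma cone_sym : symmetric cone.
Proof.
move=> x y; rewrite /cone eq_sym [_ && (pos x < _)]andbC.
by rewrite orbCA [(height x <= _) && _]andbCA.
Qed.

Lemma cone_simple : simple_graph cone.
Proof. by split; [exact: cone_sym | move=> x; rewrite /cone eqxx]. Qed.

Lemma cone_hub x y : hub x -> residue x != residue y -> H <= (height y).+1 -> cone x y.
Proof.
move=> hx xy hy; rewrite /cone xy /= hx andbT.
have -> : height x = H by rewrite /height hx.
rewrite hy /= /height; case: ifP => // _; have := level_lt y; lia.
Qed.

Lemma cone_low_hub x y : cone x y -> hub x -> H <= (height y).+1.
Proof. by case/and4P => _ h _ _ hx; move: h; rewrite /height hx. Qed.

Lemma site_hub p : hub (site H p).
Proof. by have [] := site_top p. Qed.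

Lemma residue_site_hub r : r < k -> residue (site H r) = r.
Proof. by have [_ _ ->] := site_top r => /modn_small. Qed.

Lemma cone_connected : connected_graph cone.
Proof.
have cs : connect_sym cone by apply: (sym_connect_sym cone_sym).
suff h x : connect cone x (site H 0).
  by move=> x y; apply: (connect_trans (h x)); rewrite cs.
have k0 : 0 < k by apply: ltnW.
have hubs y : hub y -> connect cone y (site H 0).
  move=> hy; have hz r : H <= (height (site H r)).+1.
    by have [_ -> _] := site_top r.
  case: (eqVneq (residue y) 0) => [y0|ny0]; last first.
    by apply/connect1/cone_hub; rewrite ?residue_site_hub.
  (* A spare copy of hub 0 is not adjacent to [site H 0], hence the detour through [site H 1]. *)
  apply: (@connect_trans _ _ (site H 1)); apply/connect1/cone_hub;
    by rewrite ?site_hub ?residue_site_hub ?y0.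
move: {2}(H - height x) (leqnn (H - height x)) => d.
elim: d x => [|d IH] x hd; case: (boolP (hub x)) => nx; try exact: hubs.
  by move: hd; rewrite /height (negbTE nx); have := level_lt x; clear; lia.
have ex := low_site nx; have px := pos_lt nx.
(* Climbing a row needs another residue, so it goes to a neighboring position. *)
pose q := if (pos x).+1 < W then (pos x).+1 else (pos x).-1.
have [qW qx qk xk] : [/\ q < W, pos x != q, pos x < q + k & q < pos x + k].
  by rewrite /q; move: px hk kW; clear; case: ifP; split; lia.
have lx := level_lt x.
have xy : cone x (site (level x).+1 q).
  by rewrite {1}ex; apply: cone_site => //; move: lx; clear; lia.
apply: (connect_trans (connect1 xy)); apply: IH.
move: hd; rewrite height_site // /height (negbTE nx); move: lx; clear; lia.
Qed.

Definition near x y := (y == x) || cone x y.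

Definition clique_at w h r := site h (in_window k w r).

Lemma clique_at_residue w h r : h <= H -> w + k <= W -> r < k ->
  residue (clique_at w h r) = r.
Proof.
move=> hh wW rk; have [h1 h2] := in_windowP hk w r.
by rewrite residue_site ?h2 ?modn_small //; move: h1 wW; clear; lia.
Qed.

Lemma clique_at_adj w h h' p r : h <= H -> h' <= H -> h <= h'.+1 -> h' <= h.+1 ->
  w + k <= W -> w <= p < w + k -> r < k -> p %% k != r ->
  cone (site h p) (clique_at w h' r).
Proof.
move=> hh hh' d d' wW wp rk pr; have [h1 h2] := in_windowP hk w r.
have nq : p != in_window k w r.
  by apply: contraNneq pr => ->; rewrite h2 modn_small.
by apply: cone_site => //; move: h1 wp wW; clear; lia.
Qed.

Lemma window_two p q : p < W -> q < W -> p < q + k -> q < p + k ->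
  exists w, [/\ w + k <= W, w <= p < w + k & w <= q < w + k].
Proof.
move=> pW qW pq qp; exists (minn (minn p q) (W - k)).
by move: pW qW pq qp kW; clear; split; lia.
Qed.

(** * Rigidity of proper colorings with k colors *)

Section Coloring.
Variables (S : {set 'I_n}) (c : 'I_n -> 'I_k).
Hypothesis cP : proper_on cone S c.

Lemma clique_inj (f : nat -> 'I_n) :
  (forall r, r < k -> f r \in S) ->
  (forall r s, r < k -> s < k -> r != s -> cone (f r) (f s)) ->
  injective (fun r : 'I_k => c (f r)).
Proof.
move=> fS fK r s e; apply: val_inj; apply/eqP; apply: contraT => rs.
by have := cP (fS r (ltn_ord r)) (fS s (ltn_ord s)) (fK _ _ (ltn_ord r) (ltn_ord s) rs); rewrite e eqxx.
Qed.

(* The clique uses all [k] colors, so that [u] must take the only one left. *)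
Lemma clique_exchange (f : nat -> 'I_n) u r :
  (forall r, r < k -> f r \in S) ->
  (forall r s, r < k -> s < k -> r != s -> cone (f r) (f s)) ->
  u \in S -> r < k -> (forall s, s < k -> s != r -> cone u (f s)) -> c u = c (f r).
Proof.
move=> fS fK uS rk uf; have [g gK Kg] := injF_bij (clique_inj fS fK).
rewrite -[c u]Kg /=; congr (c (f _)); apply/eqP; apply: contraT => ne.
have := cP uS (fS _ (ltn_ord (g (c u)))) (uf _ (ltn_ord _) ne).
by have /= -> := Kg (c u); rewrite eqxx.
Qed.

Definition rigid_at x (f : nat -> 'I_k) :=
  {in [pred r | r < k] &, injective f} /\ forall y, near x y -> c y = f (residue y).

(** [x] lies in cliques of size [k], which use every color: hubs if [x] is a hub, otherwise windows
    of its row, where sliding a window by one shows that positions [k] apart agree ([same]). Each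
    neighbor of [x] is adjacent to all vertices of other residues in such a clique. *)
Lemma rigid x : {subset near x <= S} -> exists f, rigid_at x f.
Proof.
move=> xS; have near_adj y : cone x y -> y \in S by move=> h; apply: xS; rewrite unfold_in /near h orbT.
have xxS : x \in S by apply: xS; rewrite unfold_in /near eqxx.
have inj (f : nat -> 'I_n) : (forall r, r < k -> f r \in S) ->
    (forall r s, r < k -> s < k -> r != s -> cone (f r) (f s)) ->
    {in [pred r | r < k] &, injective (fun r => c (f r))}.
  move=> fS fK r s rk sk e.
  by have := clique_inj fS fK (x1 := Ordinal rk) (x2 := Ordinal sk) e; case.
case: (boolP (hub x)) => hx.
  (* [x] replaces the hub of its own residue, to which it is not adjacent. *)
  pose f r := if r == residue x then x else site H r.
  have fS r : r < k -> f r \in S.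
    move=> rk; rewrite /f; case: eqP => // /eqP rx; apply: near_adj.
    by apply: cone_hub; rewrite ?residue_site_hub 1?eq_sym // /height site_hub.
  have fc r : r < k -> residue (f r) = r.
    by move=> rk; rewrite /f; case: eqP => [->//|_]; rewrite residue_site_hub.
  have fh r : hub (f r) by rewrite /f; case: eqP => // _; apply: site_hub.
  have fK r s : r < k -> s < k -> r != s -> cone (f r) (f s).
    by move=> rk sk rs; apply: cone_hub; rewrite ?fc // /height fh.
  exists (fun r => c (f r)); split; first exact: inj.
  move=> y /orP[/eqP->|xy]; first by rewrite /f eqxx.
  apply: clique_exchange => //; [exact: near_adj | exact: residue_lt |].
  move=> s sk sy; rewrite cone_sym; apply: cone_hub; rewrite ?fc //.
  exact: cone_low_hub xy hx.
have ex := low_site hx; have px := pos_lt hx; have lx := level_lt x.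
set h := level x in ex lx; set p := pos x in ex px.
have hH' : h <= H by apply: ltnW.
have siteS q : q < W -> q < p + k -> p < q + k -> site h q \in S.
  move=> qW qp pq; case: (eqVneq p q) => [<-|ne]; first by rewrite -ex.
  by apply: near_adj; rewrite ex; apply: cone_site.
have cS w : w + k <= W -> w <= p < w + k -> forall r, r < k -> clique_at w h r \in S.
  move=> wW wp r rk; have [h1 _] := in_windowP hk w r.
  by apply: siteS; move: h1 wW wp; clear; lia.
have cK w : w + k <= W -> w <= p < w + k -> forall r s, r < k -> s < k -> r != s ->
    cone (clique_at w h r) (clique_at w h s).
  move=> wW wp r s rk sk rs; have [h1 h2] := in_windowP hk w r.
  by apply: clique_at_adj => //; rewrite h2 modn_small.
have same (z z' : nat) : z < W -> z' < W -> z < p + k -> p < z + k -> z' < p + k -> p < z' + k ->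
    z %% k = z' %% k -> c (site h z) = c (site h z').
  wlog zz : z z' / z < z' => [th|] zW zW' h1 h2 h3 h4 e.
    case: (ltngtP z z') => [zz|zz|->//]; first exact: th.
    by symmetry; apply: th.
  have ez : z' = z + k.
    apply/eqP; apply: contraT => ne; have := @modn_neq k _ _ ne; rewrite modnDr e eqxx /=.
    by move=> h'; apply: h'; move: zz h1 h2 h3 h4; clear; lia.
  have zw : z.+1 + k <= W by rewrite addSn -ez.
  have zp : z.+1 <= p < z.+1 + k by move: zz ez h1 h2 h3 h4; clear; lia.
  have -> : z' = in_window k z.+1 (z %% k).
    have [i1 i2] := in_windowP hk z.+1 (z %% k).
    apply: (window_inj (k := k) (w := z.+1)) => //; first by move: ez hk; clear; lia.
    by rewrite i2 modn_mod.
  apply: (clique_exchange (cS _ zw zp) (cK _ zw zp)); [exact: siteS | exact: ltn_modk|].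
  move=> s sk sz; have [i1 i2] := in_windowP hk z.+1 s.
  have nz : in_window k z.+1 s != z + k.
    by apply: contraNneq sz => ez'; rewrite -(modn_small sk) -i2 ez' modnDr.
  by apply: cone_site => //; move: i1 zw nz; clear; lia.
have pp : p < p + k by move: hk; clear; lia.
have [w [wW wp _]] := window_two px px pp pp.
exists (fun r => c (clique_at w h r)); split; first by apply: inj; [exact: cS | exact: cK].
move=> y /orP[/eqP->|xy].
  have [i1 i2] := in_windowP hk w (residue x).
  rewrite [in LHS]ex; congr (c (site h _)); apply: window_inj wp i1 _.
  by rewrite i2 {1}ex residue_site // modn_mod.
case: (boolP (hub y)) => hy.
  apply: (clique_exchange (cS _ wW wp) (cK _ wW wp)); [exact: near_adj | exact: residue_lt|].
  move=> s sk sy; have [i1 _] := in_windowP hk w s.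
  apply: cone_hub => //; first by rewrite clique_at_residue // eq_sym.
  rewrite height_site //; last by move: i1 wW; clear; lia.
  by rewrite cone_sym in xy; have := cone_low_hub xy hy; rewrite {1}/height (negbTE hx).
have ey := low_site hy; have py := pos_lt hy; have ly := level_lt y.
have [cxy lxy lyx dxy] := and4P xy.
rewrite (negbTE hx) (negbTE hy) /= -/p in dxy; case/andP: dxy => pq qp.
rewrite /height (negbTE hx) (negbTE hy) -/h in lxy lyx.
set h' := level y in ey ly lxy lyx; set q := pos y in ey py pq qp.
have cy : residue y = q %% k by rewrite ey residue_site // ltnW.
(* A window around [p] and [q] gives the color of [y]; [same] compares it with the window [w]. *)
have [w1 [w1W w1p w1q]] := window_two px py pq qp.
have -> : c y = c (clique_at w1 h (residue y)).
  apply: (clique_exchange (cS _ w1W w1p) (cK _ w1W w1p)); [exact: near_adj | exact: residue_lt|].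
  move=> s sk sy; rewrite ey; apply: clique_at_adj => //; first exact: ltnW.
  by rewrite -cy eq_sym.
have [i1 i2] := in_windowP hk w1 (residue y); have [i3 i4] := in_windowP hk w (residue y).
apply: same; try (by move: i1 i3 w1p wp wW w1W; clear; lia).
by rewrite i2 i4.
Qed.

(** This forces the residue colorings at both ends of an edge to agree, so that rigidity spreads
    along paths. *)
Lemma common_near x y r : cone x y -> r < k -> exists z, [/\ residue z = r, near x z & near y z].
Proof.
move=> xy rk; case: (eqVneq (residue x) r) => [xr|nx].
  by exists x; split=> //; rewrite /near ?eqxx // cone_sym xy orbT.
case: (eqVneq (residue y) r) => [yr|ny].
  by exists y; split=> //; rewrite /near ?eqxx // xy orbT.
wlog hxy : x y xy nx ny / hub y -> hub x => [th|].
  case: (boolP (hub y)) => hy; last by apply: th => //; rewrite (negbTE hy).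
  have yx : cone y x by rewrite cone_sym.
  by have [z [z1 z2 z3]] := th y x yx ny nx (fun=> hy); exists z.
case: (boolP (hub x)) => hx.
  have hz : H <= (height (site H r)).+1 by rewrite /height site_hub.
  have cz := residue_site_hub rk.
  exists (site H r); split=> //; apply/orP; right.
    by apply: cone_hub; rewrite ?cz.
  rewrite cone_sym; apply: cone_hub; rewrite ?site_hub ?cz 1?eq_sym //.
  exact: cone_low_hub xy hx.
have hy : ~~ hub y by apply: contraNN hx.
have ex := low_site hx; have px := pos_lt hx; have lx := level_lt x.
have ey := low_site hy; have py := pos_lt hy; have ly := level_lt y.
have [cxy lxy lyx dxy] := and4P xy.
rewrite (negbTE hx) (negbTE hy) /= in dxy; case/andP: dxy => pq qp.
rewrite /height (negbTE hx) (negbTE hy) in lxy lyx.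
have [w [wW wp wq]] := window_two px py pq qp.
exists (clique_at w (level x) r); split; first by rewrite clique_at_residue // ltnW.
  rewrite /near [X in cone X _]ex clique_at_adj ?orbT //; try exact: ltnW.
  by rewrite -(residue_site (ltnW lx) px) -ex.
rewrite /near [X in cone X _]ey clique_at_adj ?orbT //; try exact: ltnW.
by rewrite -(residue_site (ltnW ly) py) -ey.
Qed.

Lemma rigid_edge x y f g : cone x y -> rigid_at x f -> rigid_at y g ->
  forall r, r < k -> f r = g r.
Proof.
move=> xy [_ hf] [_ hg] r rk; have [z [<- zx zy]] := common_near xy rk.
by rewrite -hf // hg.
Qed.

End Coloring.

Lemma near_ball (V : {set 'I_n}) x l : 0 < l -> x \in V -> {subset near x <= ball cone V l}.
Proof.
case: l => // l _ xV y xy; rewrite /ball iterS.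
have xb : x \in iter l (nbhd cone) V.
  by elim: l => //= l IH; rewrite in_nbhd IH.
rewrite in_nbhd; case/orP: xy => [/eqP->|xy]; first by rewrite xb.
by apply/orP; right; apply/existsP; exists x; rewrite xb.
Qed.

Lemma rigid_connected (V : {set 'I_n}) (E : rel 'I_n) (c : 'I_n -> 'I_k) x :
  (forall x y, E x y -> [&& x \in V, y \in V & cone x y]) ->
  proper_on cone (ball cone V k) c -> x \in V ->
  (forall y, y \in V -> connect E x y) ->
  exists2 f : nat -> 'I_k, {in [pred r | r < k] &, injective f} &
    forall y, y \in V -> c y = f (residue y).
Proof.
move=> EV cP xV conn.
have rg y : y \in V -> exists f, rigid_at c y f.
  by move=> yV; apply: (rigid cP); apply: near_ball => //; apply: ltnW.
have [f hf] := rg x xV; exists f; first by case: hf.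
suff h p y : y \in V -> path E y p -> rigid_at c y f -> rigid_at c (last y p) f.
  move=> y yV; have /connectP[p pp ->] := conn y yV.
  by have [_ ->] := h p x xV pp hf; rewrite // /near eqxx.
elim: p y => //= z p IH y yV /andP[/EV/and3P[_ zV yz]] pp hy.
apply: IH => //; have [g hg] := rg z zV.
have e := rigid_edge yz hy hg.
case: hg hy => _ hg [fi _]; split=> // u hu.
by rewrite hg // e // residue_lt.
Qed.

Lemma cone_in_L : in_L k k cone.
Proof.
split.
  exists (fun x => Ordinal (residue_lt x)) => x y _ _ /and4P[h _ _ _].
  by apply: contraNneq h => -[->].
move=> V E EV _ conn c1 c2 P1 P2.
case: (set_0Vmem V) => [V0|[x xV]].
  by exists 1%g => v; rewrite V0 inE.
have [f1 i1 h1] := rigid_connected EV P1 xV (conn x ^~ xV).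
have [f2 i2 h2] := rigid_connected EV P2 xV (conn x ^~ xV).
have inj f : {in [pred r | r < k] &, injective f} -> injective (fun r : 'I_k => f r : 'I_k).
  by move=> i r s e; apply: val_inj; apply: i => //; apply: ltn_ord.
exists ((perm (inj _ i1))^-1 * perm (inj _ i2))%g => v vV.
rewrite h1 // h2 // permM -[residue v]/(val (Ordinal (residue_lt v))).
by rewrite -[f1 _](permE (inj _ i1)) permK permE.
Qed.

End Cone.

(** * The lower bound *)

Lemma widthS k T l : (width k T l).+1 = 2 ^ l * (margin k T).*2.+1 + 2 ^ l * k.
Proof.
elim: l => [|l IH] /=; first by rewrite expn0; clear; lia.
by rewrite expnS; move: IH; clear; nia.
Qed.

Lemma not_solves n M k T (id : 'I_n -> 'I_M) (A : view M -> nat) :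
  2 <= k -> injective id -> T.+2 * width k T (4 * k * T.+2).+1 + k <= n ->
  ~ solves n M k k T A.
Proof.
(* A ball of radius [T] around row 0 stays on levels up to [T], below the top row [T.+1]. Climbing
   costs [4 * k] per row, and [l] exceeds the total by one. *)
move=> hk idI; set H := T.+2; set l := _.+1; set W := width k T l => hn sol.
have n0 : 0 < n by move: hn hk; clear; lia.
pose v0 := Ordinal n0.
have hH : 0 < H by [].
have hHW : H * W <= n by move: hn; clear; lia.
have kW : k <= W.
  by have := widthS k T l; rewrite -/W; have := expn_gt0 2 l; rewrite /=; clear; nia.
have [||arr [hi [ord [ap hhi uo mo]]]] :=
  @adversary n M k T H W id A v0 hk hH hHW l 0 (fun _ _ => false) [::] (leqnn _).
- by [].
- by [].
rewrite cat0s; set f := fun p => _ => /= Hf.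
have HW : W = width k T l by [].
rewrite -HW in ap hhi mo.
pose e : rel 'I_n := @cone n k H W arr.
pose s := ord ++ [seq x <- enum 'I_n | x \notin ord].
have us : uniq s.
  rewrite cat_uniq uo filter_uniq ?enum_uniq // andbT /=.
  by apply/hasPn => x; rewrite mem_filter => /andP[].
have ss : size s = n.
  have : s =i enum 'I_n.
    by move=> x; rewrite mem_cat mem_filter mem_enum andbT orbN.
  by move/(uniq_perm us (enum_uniq _))/perm_size => ->; rewrite size_enum_ord.
have [pr rg] := sol e (@cone_simple n k H W arr) (cone_connected v0 hk hH kW hn ap)
  (cone_in_L v0 hk hH kW hn ap) id idI s us ss.
pose c := online_coloring e id s T A.
pose F h p := c (site k H W v0 arr h p).
(* Two rows at most one apart, spliced at [t], are validly colored since the edges between them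
   follow the same rule as inside a row; [drift_row] needs this. *)
have Fv h h' a b t : h <= H -> h' <= H -> h <= h'.+1 -> h' <= h.+1 -> b <= W ->
    valid k (fun x => if x < t then F h' x else F h x) a b.
  move=> hh hh' d d' bW; apply/validP; split=> [p hp|p q ap' pq qb].
    by case: ifP => _; apply: rg.
  have adj i j : (i == h) || (i == h') -> (j == h) || (j == h') -> F i p != F j q.
    move=> hi' hj; apply/eqP/pr.
    apply: cone_site => //; try (by move: pq qb bW hi' hj hh hh' d d'; clear; lia).
  by case: ifP => _; case: ifP => _; apply: adj; rewrite eqxx ?orbT.
(* On the cone, the algorithm sees exactly what it saw on the strip. *)
have Ff p : margin k T <= p < hi -> F 0 p = f p.
  move=> hp; have pW : p < W by move: hp hhi; clear; lia.
  have eS : site k H W v0 arr 0 p = vertex H v0 (nth 0 arr p) 0 by [].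
  have [nh hh hps _] := site_low v0 hk hH kW hn ap hH pW.
  have vo : vertex H v0 (nth 0 arr p) 0 \in ord.
    rewrite mo -eS hps hp andbT /block leq0n add0n ltnNge.
    by rewrite -/(@hub n H W _) nh eS (level_vertex v0 hHW (nth_arr ap pW) hH).
  symmetry; rewrite /F /c /f eS.
  apply: (@online_coloring_local _ _ _ _ _ _ _ _ _ _
    (fun t x => ~~ @hub n H W x && (level H x <= t))) => //.
  - by move=> x; rewrite mo /block leq0n add0n ltnNge => /and3P[hx /eqP-> _]; rewrite andbT.
  - by move=> t x _ /andP[-> /leqW].
  - move=> t x y _ /andP[_ lx] /and5P[_ yA _ lyx _].
    by rewrite -(mem_arr H ap) yA (leq_trans lyx).
  - by move=> x y /andP[hx lx]; apply: (cone_strip k ap).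
have vf : valid k f (margin k T) hi.
  apply: (@eq_valid k (fun x => if x < 0 then F 0 x else F 0 x)) => [x hx|].
    by rewrite Ff.
  by apply: valid_sub (Fv 0 0 0 W 0 _ _ _ _ _) _ _ => //; move: hhi; clear; lia.
have [a [m [la ah dl]]] := Hf vf.
have hiW : hi <= W by move: hhi; clear; lia.
have dF : drift k f a m = drift k (F 0) a m.
  by rewrite /drift (@eq_walk k f (F 0)) // => x hx; rewrite Ff //; move: hx la ah; clear; lia.
have chain h : h <= H -> drift k (F 0) a m <= drift k (F h) a m + 4 * k * h.
  elim: h => [|h IH] hh; first by rewrite muln0 addn0.
  apply: leq_trans (IH (ltnW hh)) _.
  have : drift k (F h) a m <= drift k (F h.+1) a m + 4 * k.
    apply: (drift_row hk) => t _; apply: Fv; move: hh ah hiW; clear; lia.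
  by rewrite mulnS; clear; lia.
have := chain H (leqnn H); rewrite (@drift_periodic k (F H)); last first.
  by move=> x; rewrite /F /site ltnn modnDr.
by rewrite -dF add0n leqNgt dl.
Qed.

(** In the exponent, [8 * k + 1] accounts for [2 ^ l], [k] for the factor [k], 2 for the two factors
    [t], and 4 for the constant 16. *)
Lemma size_bound k T : 2 <= k ->
  T.+2 * width k T (4 * k * T.+2).+1 + k <= 2 ^ ((9 * k + 7) * T.+1).
Proof.
move=> hk; set l := (4 * k * T.+2).+1; set t := T.+1.
have ll : l <= (8 * k + 1) * t by rewrite /l /t; clear; nia.
have w1 : width k T l < 2 ^ l * (4 * t * k).
  by rewrite widthS /margin -/t; move: hk (expn_gt0 2 l) (ltn0Sn T); rewrite -/t; clear; nia.
have h1 : T.+2 * width k T l + k <= 2 * (2 * t * (2 ^ l * (4 * t * k))).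
  have : k <= 2 ^ l * (4 * t * k) by move: (expn_gt0 2 l) (ltn0Sn T); rewrite -/t; clear; nia.
  have : T.+2 <= 2 * t by rewrite /t; clear; lia.
  move: w1 (ltn0Sn T); rewrite -/t; clear; nia.
apply: leq_trans h1 _.
have tt : t <= 2 ^ t by apply/ltnW/ltn_expl.
have kk : k <= 2 ^ (k * t).
  apply: leq_trans (ltnW (ltn_expl k (isT : 1 < 2))) _.
  by rewrite leq_exp2l // leq_pmulr.
have e2 : 2 ^ l <= 2 ^ ((8 * k + 1) * t) by rewrite leq_exp2l.
apply: (@leq_trans (2 ^ 4 * 2 ^ t * 2 ^ t * 2 ^ (k * t) * 2 ^ ((8 * k + 1) * t))).
  have -> : 2 * (2 * t * (2 ^ l * (4 * t * k))) = 2 ^ 4 * t * t * k * 2 ^ l.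
    by rewrite (_ : 2 ^ 4 = 16) //; clear; nia.
  by rewrite !leq_mul.
by rewrite -!expnD leq_exp2l // /t; clear; nia.
Qed.

Theorem theorem5 (k : nat) (hk : 2 <= k) (d : nat) (hd : 1 <= d) :
  exists c : nat, 0 < c /\
  exists N : nat, forall n : nat, N <= n ->
  forall (T : nat) (A : view (n ^ d) -> nat),
    solves n (n ^ d) k k T A -> trunc_log 2 n <= c * T.
Proof.
(* For positive [T], [C * T.+1 <= 2 * C * T]; the threshold [2 ^ C] settles [T = 0]. *)
set C := 9 * k + 7; exists (2 * C); split; first by rewrite /C addnS.
exists (2 ^ C) => n nN T A sol; rewrite leqNgt; apply/negP => hT.
have n0 : 0 < n by apply: leq_trans nN; rewrite expn_gt0.
have nd : n <= n ^ d by rewrite -{1}(expn1 n) leq_pexp2l.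
have idI : injective (widen_ord nd) by move=> x y /(congr1 val) /= /val_inj.
apply: (not_solves hk idI _ sol).
apply: leq_trans (size_bound T hk) _; rewrite -/C.
case: T hT {sol} => [|T] hT; first by rewrite muln1.
apply: leq_trans _ (trunc_logP (isT : 1 < 2) n0); rewrite leq_exp2l //.
by apply: leq_trans (ltnW hT); clear; nia.
Qed.
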